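(* Let $\lambda\in\mathbb{R}$ be such that $\{\lambda\}$ is a Wilton number. Then $\lambda$ is a Lebesgue point of $\varphi_1$. In particular $\varphi_2$ is differentiable at $\lambda$ and $\varphi_2'(\lambda)=2\varphi_1(\lambda)$.
   Context: $\{t\}$ is the fractional part of $t$. $B_1(t)=\{t\}-\frac12$ if $t\notin\mathbb{Z}$ and $B_1(t)=0$ if $t\in\mathbb{Z}$; $B_2(t)=\{t\}^2-\{t\}+\frac16$. Put $\varphi_1(t)=\sum_{n\ge1}B_1(nt)/n$ and $\varphi_2(t)=\sum_{n\ge1}B_2(nt)/n^2$. The series $\varphi_1(t)$ converges for almost every $t$, and in particular at every $t$ such that $\{t\}$ is a Wilton number; it defines a $1$-periodic function integrable on $[0,1]$. For $x\in X=(0,1)\setminus\mathbb{Q}$ put $\alpha(x)=\{1/x\}$, $\alpha_0(x)=x$, $\alpha_k(x)=\alpha(\alpha_{k-1}(x))$ for $k\ge1$, $\beta_{-1}=1$, $\beta_k(x)=\alpha_0(x)\cdots\alpha_k(x)$, $\gamma_k(x)=\beta_{k-1}(x)\log(1/\alpha_k(x))$. A number $x\in X$ is a Wilton number if the series $\mathcal{W}(x)=\sum_{k\ge0}(-1)^k\gamma_k(x)$ converges. A point $x$ is a Lebesgue point of a locally integrable function $f$ (defined at $x$) if $\lim_{h\to0}\frac1h\int_x^{x+h}|f(t)-f(x)|\,dt=0$. *)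

(* Defs.v *)
From HB Require Import structures.
From mathcomp Require Import all_boot all_order all_algebra.
From mathcomp Require Import all_classical all_reals all_analysis.

Set Implicit Arguments.
Unset Strict Implicit.
Unset Printing Implicit Defensive.

Import Order.TTheory GRing.Theory Num.Theory.
Import numFieldNormedType.Exports.

Local Open Scope classical_set_scope.
Local Open Scope ring_scope.

Definition frac_part {R : realType} (t : R) : R := t - (Num.floor t)%:~R.

Definition B1 {R : realType} (t : R) : R :=
  if t \is a Num.int then 0 else frac_part t - 2^-1.

Definition B2 {R : realType} (t : R) : R := frac_part t ^+ 2 - frac_part t + 6^-1.

Definition phi1_sum {R : realType} (t : R) (N : nat) : R :=
  \sum_(1 <= n < N.+1) B1 (n%:R * t) / n%:R.

Definition phi2_sum {R : realType} (t : R) (N : nat) : R :=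
  \sum_(1 <= n < N.+1) B2 (n%:R * t) / n%:R ^+ 2.

(* [limn] is total: [phi1 t] is the sum of the series only when
   [cvgn (phi1_sum t)] holds, and a fixed default value otherwise. *)
Definition phi1 {R : realType} (t : R) : R := limn (phi1_sum t).

Definition phi2 {R : realType} (t : R) : R := limn (phi2_sum t).

Definition gauss_map {R : realType} (x : R) : R := frac_part x^-1.

Definition alpha {R : realType} (k : nat) (x : R) : R := iter k gauss_map x.

(* Indices are shifted by one: [beta_pred k x] is $\beta_{k-1}(x)$, so that
   [beta_pred 0 x] is $\beta_{-1} = 1$. *)
Definition beta_pred {R : realType} (k : nat) (x : R) : R :=
  \prod_(i < k) alpha i x.

Definition gamma_ {R : realType} (k : nat) (x : R) : R :=
  beta_pred k x * ln (alpha k x)^-1.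

Definition wilton_term {R : realType} (x : R) (k : nat) : R :=
  (-1) ^+ k * gamma_ k x.

Definition wilton_number {R : realType} (x : R) : Prop :=
  [/\ 0 < x < 1, irrational x & cvgn (series (wilton_term x))].

(* $\int_a^b f$ with the usual sign convention when $b < a$. *)
Definition oriented_int {R : realType} (f : R -> R) (a b : R) : R :=
  if a <= b then \int[lebesgue_measure]_(t in `[a, b]) f t
  else - \int[lebesgue_measure]_(t in `[b, a]) f t.

(* The library's [lebesgue_pt] averages over the symmetric balls
   $(x - r, x + r)$; here the intervals have $x$ as an endpoint, and [h] tends
   to 0 from both sides. *)
Definition lebesgue_point {R : realType} (f : R -> R) (x : R) : Prop :=
  locally_integrable setT f /\
  h^-1 * oriented_int (fun t => `|f t - f x|) x (x + h) @[h --> 0^'] --> 0.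

(* Main.v *)
Require Import Defs.
From HB Require Import structures.
From mathcomp Require Import all_boot all_order all_algebra.
From mathcomp Require Import all_classical all_reals all_analysis.
From mathcomp Require Import measurable_realfun ring lra zify.

Set Implicit Arguments.
Unset Strict Implicit.
Unset Printing Implicit Defensive.

Import Order.TTheory GRing.Theory Num.Theory.
Import numFieldNormedType.Exports.

Local Open Scope classical_set_scope.
Local Open Scope ring_scope.

(** Write [S_N(t)] for the [N]-th partial sum of [phi1(t)]; [t] is the Wilton point
    [lambda], and [x] its fractional part.

    Convergence at [x]. Counting the lattice points below the line of slope [x] by
    columns and by rows gives
      [S_N(x) + x S_M(1 / x) = - log (1 / x) / 2 + O(1)], where [M] is the integral
    part of [N x], assumed positive, and the left-hand side converges as [N] grows
    ([sum_truncn_exchange], [reciprocity_asymptotics]). As [S_M] has period 1, [1 / x]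
    may be replaced by its image [alpha(x)] under the Gauss map. Iterating until no
    term is left compares [beta_(k-1) S_N(alpha_k)] with a block of consecutive terms
    of the Wilton series, starting at [k], up to the tail of the convergent series of
    the [beta_j] ([phi1_sum_wilton_block]). Hence, for large [k], these quantities are
    small uniformly in [N], while [S_N(x)] differs from plus or minus such a quantity
    by a convergent sequence ([phi1_sum_descent]); so [S_N(x)] is a Cauchy sequence.

    Approximation. The only other consequence of the Wilton condition that is used is
    that [gamma_k] tends to 0. It implies that the distance from [q x] to the integers
    is at least [exp (- e q)] up to a constant, for every [e > 0]
    ([gamma_cvg0_subexp]).

    Oscillation. Fix [A]. If [h] is small and [N <= A / h], then [S_N] varies by at
    most [e] on the segment of radius [h] around the point ([phi1_sum_osc]). Choose a
    convergent [p / q] of [x] with [q <= 1 / (2 I sqrt h)] and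
    [|q x - p| <= 2 I sqrt h], where [I] is a large constant; then [log (1 / h)] is
    small compared with [q]. Up to [I q] terms, only one rational number of the
    segment can make terms jump, and its denominator is also large compared with
    [log (1 / h)]. Beyond, consecutive [q] terms are taken at nearly equally spaced
    points modulo 1, so that their numerators have a bounded sum ([sum_B1_block]);
    the blocks contribute [O((log N) / q)] and the ends [O(1 / I)].

    Mean value of the tail. The integral over a period of [B1(m t) B1(n t)] is
    [gcd(m, n) ^ 2 / (12 m n)] ([Rintegral_B1_correlation]), whence the mean square
    of [S_M - S_N] over a period is [O(1 / N)] for [M >= N] ([phi1_sum_L2]). Along
    the fourth powers this yields almost everywhere convergence, since [S_N] varies
    little between them ([phi1_sum_cvg_ae]), and by Fatou's lemma the mean of
    [|phi1 - S_N|] over a segment of length [h] is small when [N h] is large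
    ([phi1_L1]).

    Conclusion. Take [N = A / h] with [A] large: on a segment of length [h] that
    contains the point, [phi1] is close in mean to [S_N], which is uniformly close to
    its value at the point, itself close to the sum of the series
    ([phi1_mean_oscillation]). This is the Lebesgue point property. Termwise
    integration shows that [phi2] is an integral of [2 phi1] ([phi2_diff]), so its
    derivative at a Lebesgue point is [2 phi1]. *)

(** * Fractional parts and the sawtooth function *)

Section FracPart.
Context {R : realType}.
Implicit Types (t u x : R) (z : int).

Lemma frac_part_itv t : 0 <= frac_part t < 1.
Proof.
have /andP[h1 h2] := floor_itv t; rewrite /frac_part.
by move: h2; rewrite intrD; lra.
Qed.

Lemma frac_partDz t z : frac_part (t + z%:~R) = frac_part t.
Proof.
rewrite /frac_part floorDrz ?intr_int// intrKfloor intrD; ring.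
Qed.

Lemma frac_part_eq u z : 0 <= u < 1 -> frac_part (z%:~R + u) = u.
Proof.
move=> u01; rewrite /frac_part (@floor_def _ _ z) ?intrD; lra.
Qed.

Lemma B1_eq u z : 0 < u < 1 -> B1 (z%:~R + u) = u - 2^-1.
Proof.
move=> u01; rewrite /B1 frac_part_eq; last lra.
rewrite ifF//; apply/negP => /intrP[w hw].
have hu : u = (w - z)%:~R by rewrite intrB -hw; lra.
by move: u01; rewrite hu ltr0z ltrz1; lia.
Qed.

Lemma B1_int z : B1 (z%:~R : R) = 0.
Proof. by rewrite /B1 intr_int. Qed.

Lemma sawtooth_cases t :
  (exists z, t = z%:~R) \/ (exists z u, 0 < u < 1 /\ t = z%:~R + u).
Proof.
have /andP[h0 h1] := frac_part_itv t.
have ht : t = (Num.floor t)%:~R + frac_part t by rewrite /frac_part; ring.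
have [h|h] := eqVneq (frac_part t) 0.
  by left; exists (Num.floor t); rewrite {1}ht h addr0.
right; exists (Num.floor t), (frac_part t); split => //.
by rewrite lt_neqAle eq_sym h h0 h1.
Qed.

Lemma B1_bound t : `|B1 t| <= 2^-1.
Proof.
have [[z ->]|[z [u [u01 ->]]]] := sawtooth_cases t.
  by rewrite B1_int normr0.
rewrite B1_eq// ler_norml; lra.
Qed.

Lemma B1Dz t z : B1 (t + z%:~R) = B1 t.
Proof.
have [[w ->]|[w [u [u01 ->]]]] := sawtooth_cases t.
  by rewrite -intrD !B1_int.
by rewrite addrAC -intrD !B1_eq.
Qed.

Lemma B1N t : B1 (- t) = - B1 t.
Proof.
have [[w ->]|[w [u [u01 ->]]]] := sawtooth_cases t.
  by rewrite -mulrNz !B1_int oppr0.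
have -> : - (w%:~R + u) = (- w - 1)%:~R + (1 - u) :> R by rewrite intrB mulrNz; ring.
rewrite !B1_eq//; lra.
Qed.

(** Equality fails only at the integers, where [B1] is normalized to 0 rather than
    [- 1 / 2]; the inequality lets sums of [B1] be bounded without separating them. *)
Lemma B1_ge t : frac_part t - 2^-1 <= B1 t.
Proof. by rewrite /B1; case: ifP => //; rewrite intrEfloor /frac_part => /eqP ->; lra. Qed.

Lemma B1_sub t u : (forall z, ~~ (Num.min t u <= z%:~R <= Num.max t u)) ->
  B1 t - B1 u = t - u.
Proof.
have main (a b : R) : a <= b -> (forall z, ~~ (a <= z%:~R <= b)) -> B1 a - B1 b = a - b.
  move=> ab h.
  have [[z az]|[z [v [v01 az]]]] := sawtooth_cases a.
    by have := h z; rewrite -az lexx ab.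
  have bz : b < (z + 1)%:~R.
    by have := h (z + 1); rewrite az intrD; case: lerP; case: lerP => //; lra.
  have -> : b = z%:~R + (b - z%:~R) by ring.
  rewrite az !B1_eq//; first ring.
  by move: bz; rewrite intrD; lra.
by case: (leP t u) => [tu|/ltW ut] h; [|apply: oppr_inj; rewrite !opprB]; apply: main.
Qed.

(** The form of [B1_sub] used to detect jumps: [B1] can only jump between [u] and
    [t] if some integer is at least as close to [u] as [t] is. *)
Lemma B1_dist t u :
  (forall z, ~~ (`|z%:~R - u| <= `|t - u|)) -> B1 t - B1 u = t - u.
Proof.
move=> h; apply: B1_sub => z; apply: contra (h z).
case: (leP t u) => tu /andP[h1 h2]; rewrite ler_norml.
  by rewrite ler0_norm; lra.
by rewrite gtr0_norm; lra.
Qed.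

Lemma B2Dz t z : B2 (t + z%:~R) = B2 t.
Proof. by rewrite /B2 frac_partDz. Qed.

Lemma B2_eq u z : 0 <= u <= 1 -> B2 (z%:~R + u) = u ^+ 2 - u + 6^-1.
Proof.
move=> /andP[u0]; rewrite le_eqVlt => /orP[/eqP ->|u1]; last first.
  by rewrite /B2 frac_part_eq// u0.
have -> : z%:~R + 1 = (z + 1)%:~R + 0 :> R by rewrite intrD; ring.
by rewrite /B2 frac_part_eq; lra.
Qed.

End FracPart.

(** * Continued fractions and rational approximation *)

Section GaussMap.
Context {R : realType}.
Implicit Types (x : R) (k : nat).

Lemma irrational_mulrn x (n : nat) (p : int) :
  irrational x -> (0 < n)%N -> n%:R * x != p%:~R.
Proof.
move=> irr n0; apply: contra_notN irr => /eqP h; apply/rationalP.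
exists p, n; rewrite -h; field; by rewrite pnatr_eq0 -lt0n.
Qed.

Lemma irrationalP x : irrational x <->
  forall (n : nat) (p : int), (0 < n)%N -> n%:R * x <> p%:~R.
Proof.
split=> [irr n p n0|h /rationalP[p [n hx]]].
  by apply/eqP; exact: irrational_mulrn.
have [n0|n0] := posnP n.
  by apply: (h 1 0) => //; rewrite hx n0 invr0 mulr0 mulr0.
by apply: (h n p) => //; rewrite hx; field; rewrite pnatr_eq0 -lt0n.
Qed.

Definition unit_irrational x := 0 < x < 1 /\ irrational x.

Lemma invr_gauss x : unit_irrational x ->
  exists2 a : nat, (0 < a)%N & x^-1 = a%:R + gauss_map x.
Proof.
case=> /andP[x0 x1] irr; have x1' : 1 <= x^-1 by rewrite invf_ge1// ltW.
exists (Num.truncn x^-1); first by rewrite truncn_gt0.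
rewrite /gauss_map /frac_part [X in _ = X + _](_ : _ = (Num.floor x^-1)%:~R); first ring.
by rewrite truncn_floor ifT ?natr_absz ?ger0_norm// ?floor_ge0; lra.
Qed.

Lemma gauss_map_unit x : unit_irrational x -> unit_irrational (gauss_map x).
Proof.
move=> ux; have [a a0 ha] := invr_gauss ux; case: ux => /andP[x0 x1] irr.
have xg : x * gauss_map x = 1 - a%:R * x.
  have -> : gauss_map x = x^-1 - a%:R by rewrite ha; ring.
  by field; lra.
have ig : irrational (gauss_map x).
  apply/irrationalP => n p n0 e.
  have e2 : (a%:Z * n%:Z + p)%:~R * x = n%:R.
    rewrite intrD intrM -e.
    transitivity (n%:R * (x * gauss_map x + a%:R * x)); first by ring.
    by rewrite xg; ring.
  have pos : 0 < a%:Z * n%:Z + p.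
    have : 0 < (a%:Z * n%:Z + p)%:~R * x by rewrite e2 ltr0n.
    by rewrite pmulr_lgt0// ltr0z.
  move/irrationalP : irr => /(_ (absz (a%:Z * n%:Z + p)) n%:Z); apply; first lia.
  by rewrite natr_absz gtr0_norm.
split=> //; have /andP[g0 g1] := frac_part_itv x^-1.
rewrite g1 andbT lt_neqAle g0 andbT eq_sym; apply/eqP => h.
by move/irrationalP : ig => /(_ 1 0 isT); apply; rewrite mul1r.
Qed.

Lemma alphaS k x : alpha k.+1 x = gauss_map (alpha k x).
Proof. by []. Qed.

Lemma alpha_unit k x : unit_irrational x -> unit_irrational (alpha k x).
Proof. by move=> ux; elim: k => //= k; exact: gauss_map_unit. Qed.

Lemma alpha_itv k x : unit_irrational x -> 0 < alpha k x < 1.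
Proof. by move=> ux; have [] := alpha_unit k ux. Qed.

Lemma beta_pred0 x : beta_pred 0 x = 1.
Proof. by rewrite /beta_pred big_ord0. Qed.

Lemma beta_predS k x : beta_pred k.+1 x = beta_pred k x * alpha k x.
Proof. by rewrite /beta_pred big_ord_recr. Qed.

Lemma beta_pred_gt0 k x : unit_irrational x -> 0 < beta_pred k x.
Proof.
move=> ux; elim: k => [|k ih]; first by rewrite beta_pred0.
by rewrite beta_predS mulr_gt0//; have /andP[] := alpha_itv k ux.
Qed.

Lemma beta_pred_dec k x : unit_irrational x -> beta_pred k.+1 x <= beta_pred k x.
Proof.
move=> ux; rewrite beta_predS ler_piMr ?(ltW (beta_pred_gt0 _ ux))//.
by have /andP[_ /ltW] := alpha_itv k ux.
Qed.

Lemma beta_pred_homo x i j : unit_irrational x -> (i <= j)%N ->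
  beta_pred j x <= beta_pred i x.
Proof.
move=> ux; elim: j => [|j ih]; first by rewrite leqn0 => /eqP ->.
rewrite leq_eqVlt => /orP[/eqP -> //|]; rewrite ltnS => /ih; apply: le_trans.
exact: beta_pred_dec.
Qed.

Lemma beta_pred_le1 k x : unit_irrational x -> beta_pred k x <= 1.
Proof. by move=> ux; rewrite -(beta_pred0 x) beta_pred_homo. Qed.

(** The [beta_k] are the remainders of the Euclidean algorithm run on [1] and [x],
    and [a] is the partial quotient. *)
Lemma beta_pred_rec k x : unit_irrational x -> exists2 a : nat, (0 < a)%N &
  beta_pred k.+2 x = beta_pred k x - a%:R * beta_pred k.+1 x.
Proof.
move=> ux; have [a a0 ha] := invr_gauss (alpha_unit k ux); exists a => //.
rewrite !beta_predS alphaS; have /andP[h _] := alpha_itv k ux.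
have -> : gauss_map (alpha k x) = (alpha k x)^-1 - a%:R by rewrite ha; ring.
by field; lra.
Qed.

(** Telescoping: the recurrence with [a >= 1] gives
    [beta_(k+1) <= beta_(k-1) - beta_k], so no geometric decay is needed. *)
Lemma sum_beta_pred x (k K : nat) : unit_irrational x ->
  \sum_(k <= j < K) beta_pred j x <= 3 * beta_pred k x.
Proof.
move=> ux; have [Kk|kK] := leqP K k.
  by rewrite big_geq// mulr_ge0// ltW// beta_pred_gt0.
have h n : \sum_(k <= j < (k + n).+1) beta_pred j x <=
    3 * beta_pred k x - beta_pred (k + n) x - beta_pred (k + n).+1 x.
  elim: n => [|n ih].
    by rewrite addn0 big_nat1; have := beta_pred_dec k ux; lra.
  rewrite addnS big_nat_recr/=; last by rewrite (leq_trans (leq_addr n k)).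
  have [a a0 ->] := beta_pred_rec (k + n) ux.
  have : beta_pred (k + n).+1 x <= a%:R * beta_pred (k + n).+1 x.
    by rewrite ler_peMl ?ler1n// ltW// beta_pred_gt0.
  by lra.
have := h (K.-1 - k)%N; rewrite subnKC; last by lia.
rewrite prednK; last by lia.
have := beta_pred_gt0 K.-1 ux; have := beta_pred_gt0 K ux; lra.
Qed.

Lemma beta_pred_small x e : unit_irrational x -> 0 < e ->
  exists k, beta_pred k x <= e.
Proof.
move=> ux e0; pose n := (Num.truncn (3 / e)).+1; exists n.
have hn : 3 / e < n%:R by exact: truncnS_gt.
have h : n%:R * beta_pred n x <= 3.
  have := sum_beta_pred 0 n ux; rewrite beta_pred0 mulr1; apply: le_trans.
  rewrite mulr_natl -[n in _ *+ n]subn0 -sumr_const_nat.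
  by apply: ler_sum_nat => i /andP[_ ilt]; rewrite beta_pred_homo// ltnW.
have n0 : 0 < n%:R :> R by rewrite ltr0n.
rewrite -(ler_pM2l n0); apply: le_trans h _.
by move: hn; rewrite ltr_pdivrMr// => /ltW.
Qed.

(** [p / q] and [p' / q'] are two consecutive convergents of [x]; the last two
    identities bound [q] by [1 / beta_(k-1)] and make [q] and [p] coprime. *)
Lemma convergents k x : unit_irrational x -> exists (q q' : nat) (p p' : int),
  [/\ (0 < q)%N,
      q%:R * x - p%:~R = (-1) ^+ k * beta_pred k.+1 x,
      q'%:R * x - p'%:~R = - ((-1) ^+ k * beta_pred k x),
      q%:R * beta_pred k x + q'%:R * beta_pred k.+1 x = 1
    & q%:Z * p' - q'%:Z * p = (-1) ^+ k].
Proof.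
move=> ux; elim: k => [|k [q [q' [p [p' [q0 h1 h2 h3 h4]]]]]].
  exists 1, 0, 0, 1; split=> //=; rewrite ?beta_predS ?beta_pred0 /alpha /=; ring.
have [a a0 ha] := beta_pred_rec k ux.
exists (a * q + q')%N, q, (a%:Z * p + p'), p; split.
- by rewrite addn_gt0 muln_gt0 a0 q0.
- rewrite natrD natrM intrD intrM ha exprS.
  transitivity (a%:R * (q%:R * x - p%:~R) + (q'%:R * x - p'%:~R)); first by ring.
  by rewrite h1 h2; ring.
- by rewrite h1 exprS; ring.
- by rewrite ha natrD natrM -[RHS]h3; ring.
- by rewrite exprS -h4 PoszD PoszM; ring.
Qed.

(** Dirichlet's approximation theorem, with the error expressed by the
    remainders of the continued fraction: [k] is the first index such that
    [beta_k <= 1 / X]. *)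
Lemma good_approx x X : unit_irrational x -> 1 <= X ->
  exists (k q : nat) (p : int),
  [/\ (0 < q)%N, q%:R <= X, coprimez q p,
      `|q%:R * x - p%:~R| = beta_pred k.+1 x
    & beta_pred k.+1 x <= X^-1 <= beta_pred k x].
Proof.
move=> ux X1; have X0 : 0 < X by lra.
have [k hk kmin] : exists2 k, beta_pred k.+1 x <= X^-1 & X^-1 <= beta_pred k x.
  have [k hk] : exists k, beta_pred k.+1 x <= X^-1.
    have [k hk] := @beta_pred_small x X^-1 ux (ltac:(by rewrite invr_gt0)).
    by exists k; exact: le_trans (beta_pred_dec _ ux) hk.
  elim: k hk => [|k ih] hk.
    by exists 0 => //; rewrite beta_pred0 invf_le1.
  have [h|/ltW h] := leP (beta_pred k.+1 x) X^-1; first exact: ih.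
  by exists k.+1.
have [q [q' [p [p' [q0 h1 h2 h3 h4]]]]] := convergents k ux.
exists k, q, p; split=> //.
- have : q%:R * beta_pred k x <= 1.
    have : 0 <= q'%:R * beta_pred k.+1 x by rewrite mulr_ge0// ltW// beta_pred_gt0.
    by move: h3; lra.
  move=> h; have : q%:R * X^-1 <= 1.
    by apply: le_trans h; rewrite ler_wpM2l.
  by rewrite ler_pdivrMr// mul1r.
- apply/coprimezP; exists ((-1) ^+ k * p', - ((-1) ^+ k * q'%:Z)) => /=.
  transitivity ((-1) ^+ k * (q%:Z * p' - q'%:Z * p)); first ring.
  by rewrite h4 -exprD addnn -mul2n exprM sqrrN !expr1n.
- by rewrite h1 normrM normrX normrN1 expr1n mul1r gtr0_norm// beta_pred_gt0.
- by rewrite hk.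
Qed.

End GaussMap.

Section SubexpIrrational.
Context {R : realType}.
Implicit Types x : R.

(** The distance from [q x] to the integers decays slower than every exponential
    of [q]; for the convergents this says [log q_(k+1) = o(q_k)]. *)
Definition subexp_irrational x := forall e : R, 0 < e -> exists2 c, 0 < c &
  forall (q : nat) (p : int), (0 < q)%N -> c * expR (- (e * q%:R)) <= `|q%:R * x - p%:~R|.

(** A fraction [p / q] that is not the convergent [pk / qk] of comparable
    denominator misses [x] by the determinant inequality; for the convergent
    itself the error is [beta_k = beta_(k-1) alpha_k], and [gamma_k -> 0] bounds
    [alpha_k] from below. *)
Lemma gamma_cvg0_subexp x : unit_irrational x ->
  gamma_ ^~ x @ \oo --> (0 : R) -> subexp_irrational x.
Proof.
move=> ux /cvgrPdist_le g0 e e0.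
have [k0 _ hk0] := g0 (e / 4) (ltac:(lra)).
have b0 := beta_pred_gt0 k0.+1 ux.
exists (Num.min (e / 8) (beta_pred k0.+1 x / 2)).
  by rewrite lt_min; apply/andP; split; lra.
move=> q p q0; have q1 : 1 <= q%:R :> R by rewrite ler1n.
set D := `| _ |; set E := expR (- (e / 2 * q%:R)).
have -> : expR (- (e * q%:R)) = E * E by rewrite -expRD; congr expR; field.
have E0 : 0 < E by exact: expR_gt0.
have E1 : E <= 1 by rewrite -expR0 ler_expR oppr_le0 mulr_ge0//; lra.
have qE : q%:R * E <= 2 / e.
  have h := expR_ge1Dx (e / 2 * q%:R).
  rewrite /E expRN ler_pdivrMr ?expR_gt0//.
  rewrite [leLHS](_ : _ = 2 / e * (e / 2 * q%:R)); last by field; lra.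
  by rewrite ler_pM2l ?divr_gt0//; lra.
have small : e / 8 * (E * E) * (4 * q%:R) <= E.
  rewrite [leLHS](_ : _ = e / 2 * E * (q%:R * E)); last by field.
  rewrite [leRHS](_ : _ = e / 2 * E * (2 / e)); last by field; lra.
  by rewrite ler_wpM2l// mulr_ge0//; lra.
(* at [X = 2 q] the convergent has denominator at most [2 q], and [q beta_k] is at
   most 1 / 2, which is what both cases below need *)
have [k [qk [pk [qk0 qkX _ hk /andP[b1 b2]]]]] := good_approx (X := 2 * q%:R) ux (ltac:(lra)).
have q20 : 0 < 2 * q%:R :> R by lra.
have b1' : q%:R * beta_pred k.+1 x <= 2^-1.
  by move: b1; rewrite -[(_ * _)^-1]mul1r ler_pdivlMr//; lra.
have b2' : 2^-1 <= q%:R * beta_pred k x.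
  by move: b2; rewrite -[(_ * _)^-1]mul1r ler_pdivrMr//; lra.
have [w0|w0] := eqVneq (q%:Z * pk - p * qk%:Z) 0; last first.
  have : 1 <= `|(q%:Z * pk - p * qk%:Z)%:~R : R|.
    by rewrite -intr_norm ler1z -gtz0_ge1 normr_gt0.
  have -> : (q%:Z * pk - p * qk%:Z)%:~R =
     qk%:R * (q%:R * x - p%:~R) - q%:R * (qk%:R * x - pk%:~R) :> R.
    by rewrite intrB !intrM; ring.
  move=> h; have {}h : 1 <= qk%:R * D + 2^-1.
    apply: le_trans h _; apply: le_trans (ler_normB _ _) _.
    by rewrite !normrM hk !(@ger0_norm _ _%:R)// -/D; lra.
  have {}h : 1 <= 4 * q%:R * D.
    have : qk%:R * D <= 2 * q%:R * D by rewrite ler_wpM2r// normr_ge0.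
    by move: h; lra.
  have h2 : e / 8 * (E * E) <= D.
    have : e / 8 * (E * E) * (4 * q%:R) <= D * (4 * q%:R) by move: small h E1; lra.
    by rewrite ler_pM2r//; lra.
  apply: le_trans h2; rewrite ler_pM2r ?mulr_gt0//.
  by rewrite ge_min lexx.
have hD : beta_pred k.+1 x / 2 <= D.
  have : qk%:R * D = q%:R * beta_pred k.+1 x.
    rewrite -hk /D -[qk%:R in LHS](@ger0_norm R)// -[q%:R in RHS](@ger0_norm R)//.
    rewrite -!normrM; congr `| _ |.
    have : (q%:Z * pk)%:~R = (p * qk%:Z)%:~R :> R.
      by congr (_%:~R); apply/eqP; rewrite -subr_eq0 w0.
    by rewrite !intrM; lra.
  move=> h; have qk0' : 0 < qk%:R :> R by rewrite ltr0n.
  rewrite -(ler_pM2l qk0') h.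
  have : qk%:R * beta_pred k.+1 x <= 2 * q%:R * beta_pred k.+1 x.
    by rewrite ler_wpM2r// ltW// beta_pred_gt0.
  by lra.
have EE0 : 0 < E * E by rewrite mulr_gt0.
have [kk|kk] := leqP k0 k; last first.
  apply: (@le_trans _ _ (beta_pred k0.+1 x / 2 * (E * E))).
    by rewrite ler_pM2r// ge_min lexx orbT.
  have h : beta_pred k0.+1 x <= beta_pred k.+1 x.
    by apply: beta_pred_homo => //; rewrite ltnS ltnW.
  have : beta_pred k0.+1 x / 2 * (E * E) <= beta_pred k0.+1 x / 2.
    rewrite ler_piMr//; first by lra.
    by rewrite mulr_ile1// ltW.
  by move: hD; lra.
have /andP[a0 a1] := alpha_itv k ux.
have bk := beta_pred_gt0 k ux.
have ha : E <= alpha k x.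
  have := hk0 _ kk; rewrite sub0r normrN => /(le_trans (ler_norm _)).
  rewrite /gamma_ lnV ?posrE// => h.
  rewrite -(lnK (_ : alpha k x \in Num.pos)) ?posrE// ler_expR.
  have L0 : ln (alpha k x) <= 0 by rewrite ln_le0// ltW.
  have h2 : q%:R * (beta_pred k x * - ln (alpha k x)) <= q%:R * (e / 4).
    by rewrite ler_wpM2l.
  have h3 : 2^-1 * - ln (alpha k x) <= q%:R * beta_pred k x * - ln (alpha k x).
    by rewrite ler_wpM2r//; lra.
  by move: h2 h3; lra.
apply: (@le_trans _ _ (e / 8 * (E * E))).
  by rewrite ler_pM2r// ge_min lexx.
apply: le_trans hD; rewrite beta_predS.
have h3 : 2^-1 * E <= q%:R * (beta_pred k x * alpha k x).
  by rewrite mulrA; apply: ler_pM => //; lra.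
have q0' : 0 < 4 * q%:R :> R by lra.
by rewrite -(ler_pM2r q0'); lra.
Qed.

End SubexpIrrational.

(** * Sums of the sawtooth function along arithmetic progressions *)

Section Blocks.
Context {R : realType}.

Lemma ln_diff_ge (a b : R) : 0 < a -> 0 < b -> 1 - a / b <= ln b - ln a.
Proof.
move=> a0 b0; have ab : 0 < a / b by rewrite divr_gt0.
have := @le_ln1Dx R (a / b - 1) (ltac:(lra)).
by rewrite addrC subrK ln_div ?posrE//; lra.
Qed.

Lemma modz_absz_lt (q : nat) (z : int) : (0 < q)%N -> (absz (z %% q%:Z)%Z < q)%N.
Proof.
move=> q0; have h := ltz_pmod z (ltac:(by rewrite ltz_nat) : 0 < q%:Z).
by have := modz_ge0 z (ltac:(lia) : q%:Z != 0); lia.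
Qed.

(** An arithmetic progression whose step is coprime to [q] meets every residue. *)
Lemma sum_residues {V : nmodType} (q : nat) (p z : int) (f : nat -> V) :
  (0 < q)%N -> coprimez q p ->
  \sum_(r < q) f (absz ((z + r%:Z * p) %% q%:Z)%Z) = \sum_(k < q) f k.
Proof.
move=> q0 cqp.
pose g (r : 'I_q) := Ordinal (modz_absz_lt (z + r%:Z * p) q0).
have ginj : injective g.
  move=> r s [] /(congr1 Posz).
  rewrite !gez0_abs ?modz_ge0//; try lia.
  move=> /eqP; rewrite eqz_mod_dvd.
  have -> : z + r%:Z * p - (z + s%:Z * p) = (r%:Z - s%:Z) * p by ring.
  rewrite Gauss_dvdzl// -eqz_mod_dvd !modz_nat.
  rewrite !modn_small ?ltn_ord// => /eqP[] e; exact: val_inj.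
by rewrite [RHS](reindex_inj ginj).
Qed.

Lemma sum_ltn_le (n m : nat) : (\sum_(i < n) (i < m)%N <= m)%N.
Proof.
suff -> : (\sum_(i < n) (i < m)%N = minn n m)%N by exact: geq_minr.
by elim: n => [|n ih]; [rewrite big_ord0 min0n|rewrite big_ord_recr /= ih; case: (ltnP n m); lia].
Qed.

Lemma sum_nat_ord (q : nat) : (0 < q)%N ->
  \sum_(k < q) (k%:R / q%:R - 2^-1) = - 2^-1 :> R.
Proof.
move=> q0; have q0' : q%:R != 0 :> R by rewrite pnatr_eq0 -lt0n.
have h n : \sum_(k < n) (k%:R : R) = n%:R * (n%:R - 1) / 2.
  elim: n => [|n ih]; first by rewrite big_ord0; ring.
  by rewrite big_ord_recr /= ih -natr1; field.
rewrite big_split /= sumr_const card_ord -mulr_suml h -mulr_natl; field.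
by rewrite q0'.
Qed.

(** Up to shifts of size [O(1 / q)], the points [c + r t] with [r < q] are
    equally spaced modulo 1, and the sawtooth function has mean value
    [O(1 / q)] over equally spaced points. *)
Lemma sum_B1_block_ge (q : nat) (p : int) (t c : R) : (0 < q)%N -> coprimez q p ->
  `|q%:R * t - p%:~R| <= 2 / q%:R -> - 6 <= \sum_(r < q) B1 (c + r%:R * t).
Proof.
move=> q0 cqp ht; have Q0 : 0 < q%:R :> R by rewrite ltr0n.
(* after multiplication by [q], the points are [z + r p + w] with [0 <= w < 5] *)
pose z := Num.floor (q%:R * c) - 2.
(* the last term pays for the few residues that [w] may carry past the next multiple of [q] *)
pose f (k : nat) : R := k%:R / q%:R - 2^-1 - (q < k + 5)%:R.
have main (r : 'I_q) : f (absz ((z + r%:Z * p) %% q%:Z)%Z) <= B1 (c + r%:R * t).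
  apply: le_trans (B1_ge _); rewrite /f; set k := absz _.
  have dk : z + r%:Z * p = ((z + r%:Z * p) %/ q%:Z)%Z * q%:Z + k%:Z.
    by rewrite {1}(divz_eq (z + r%:Z * p) q%:Z) gez0_abs// modz_ge0//; lia.
  set d := (_ %/ _)%Z in dk.
  pose w := frac_part (q%:R * c) + 2 + r%:R * (q%:R * t - p%:~R).
  have /andP[w0 w5] : 0 <= w < 5.
    have /andP[f0 f1] := frac_part_itv (q%:R * c).
    have : `|r%:R * (q%:R * t - p%:~R)| <= 2.
      rewrite normrM ger0_norm//.
      have rq : r%:R <= q%:R :> R by rewrite ler_nat ltnW.
      apply: le_trans (ler_pM _ _ rq ht) _ => //.
      by rewrite mulrC divfK// gt_eqF.
    by rewrite ler_norml /w; lra.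
  have e : c + r%:R * t = d%:~R + (k%:R + w) / q%:R.
    have h : (z + r%:Z * p)%:~R = (d * q%:Z + k%:Z)%:~R :> R by rewrite dk.
    rewrite /z !intrD !intrM mulrNz /= in h.
    have h2 : q%:R * (c + r%:R * t) = q%:R * (d%:~R + (k%:R + w) / q%:R).
      rewrite [RHS]mulrDr (mulrC q%:R ((_ + _) / _)) divfK ?gt_eqF//.
      by rewrite /w /frac_part; move: h; rewrite -!pmulrn; lra.
    by apply: (mulfI _ h2); rewrite gt_eqF.
  have kq : (k < q)%N by exact: modz_absz_lt.
  have [hq|hq] := ltP (k%:R + w) q%:R.
    rewrite e frac_part_eq; last first.
      apply/andP; split; last by rewrite ltr_pdivrMr// mul1r.
      apply: divr_ge0 => //; exact: addr_ge0.
    have : k%:R / q%:R <= (k%:R + w) / q%:R by rewrite ler_pM2r ?invr_gt0//; lra.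
    have : 0 <= (q < k + 5)%:R :> R by [].
    by lra.
  have -> : (q < k + 5)%N by rewrite -(ltr_nat R) natrD; lra.
  have : k%:R / q%:R <= 1 :> R by rewrite ler_pdivrMr// mul1r ler_nat ltnW.
  by have /andP[] := frac_part_itv (c + r%:R * t); rewrite /=; lra.
apply: le_trans (ler_sum _ (fun r _ => main r)).
rewrite sum_residues// /f sumrB sum_nat_ord//.
rewrite -natr_sum (reindex_inj rev_ord_inj) /=.
have : (\sum_(j < q) (q < q - j.+1 + 5)%N <= 4)%N.
  apply: leq_trans (sum_ltn_le q 4); apply: leq_sum => i _.
  by have := ltn_ord i; lia.
by rewrite -(ler_nat R); lra.
Qed.

Lemma sum_B1_block (q : nat) (p : int) (t c : R) : (0 < q)%N -> coprimez q p ->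
  `|q%:R * t - p%:~R| <= 2 / q%:R -> `|\sum_(r < q) B1 (c + r%:R * t)| <= 6.
Proof.
move=> q0 cqp ht; rewrite ler_norml (sum_B1_block_ge _ q0 cqp)//=.
rewrite -lerN2 -sumrN; under eq_bigr do rewrite -B1N opprD -mulrN.
apply: (sum_B1_block_ge (p := - p)) => //; first by rewrite coprimezN.
by rewrite mulrN mulrNz -opprD normrN.
Qed.

(** In a block starting at [M], replacing the weights [1 / n] by [1 / M] costs at
    most [q (1 / M - 1 / (M + q))], and [C / M] is dominated by an increment of
    [(2 C / q) log]; both bounds telescope. *)
Lemma block_sum_bound (q : nat) (C : R) (F : nat -> R) : (0 < q)%N ->
  (forall n, `|F n| <= 2^-1) -> (forall n, `|\sum_(r < q) F (n + r)%N| <= C) ->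
  forall M N : nat, (q <= M <= N)%N ->
  `|\sum_(M <= n < N) F n / n%:R| <=
     2 * C / q%:R * (ln N%:R - ln M%:R) + q%:R * (M%:R^-1 - N%:R^-1) + q%:R / M%:R.
Proof.
move=> q0 F2 FC M N; have [m] := ubnP (N - M)%N; elim: m M => // m ih M.
move=> NM /andP[qM MN]; have Q0 : 0 < q%:R :> R by rewrite ltr0n.
have C0 : 0 <= C by exact: le_trans (FC 0).
have M0 : 0 < M%:R :> R by rewrite ltr0n; lia.
have N0 : 0 < N%:R :> R by rewrite ltr0n; lia.
have MN' : M%:R <= N%:R :> R by rewrite ler_nat.
have [short|long] := ltnP N (M + q).
  have h : `|\sum_(M <= n < N) F n / n%:R| <= q%:R / M%:R.
    apply: le_trans (ler_norm_sum _ _ _) _.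
    apply: (@le_trans _ _ (\sum_(M <= n < N) M%:R^-1)).
      apply: ler_sum_nat => n /andP[Mn _].
      have n0 : 0 < n%:R :> R by rewrite ltr0n; lia.
      rewrite normrM normfV (ger0_norm (ltW n0)) -[leRHS]mul1r.
      apply: ler_pM; rewrite ?invr_ge0//; first by have := F2 n; lra.
      by rewrite lef_pV2// ler_nat.
    rewrite sumr_const_nat -[_ *+ (N - M)]mulr_natl ler_pM2r ?invr_gt0// ler_nat; lia.
  apply: le_trans h _; rewrite lerDr addr_ge0// mulr_ge0 ?subr_ge0 ?lef_pV2//.
    by rewrite divr_ge0 ?mulr_ge0.
  by rewrite ler_ln ?posrE.
rewrite (big_cat_nat (n := (M + q)%N)) ?leq_addr//=.
apply: le_trans (ler_normD _ _) _.
have {}ih := ih (M + q)%N (ltac:(lia)) (ltac:(lia)).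
have MQ : (M + q)%:R = M%:R + q%:R :> R by rewrite natrD.
have MQ0 : 0 < (M + q)%:R :> R by rewrite ltr0n; lia.
set D := M%:R^-1 - (M + q)%:R^-1 :> R.
have first_block : `|\sum_(M <= n < M + q) F n / n%:R| <= C / M%:R + q%:R * D.
  have -> : \sum_(M <= n < M + q) F n / n%:R = \sum_(i < q) F (i + M)%N / (i + M)%:R.
    by rewrite -{1}[M]add0n big_addn addKn big_mkord.
  have -> : \sum_(i < q) F (i + M)%N / (i + M)%:R =
    (\sum_(i < q) F (M + i)%N) / M%:R +
    \sum_(i < q) F (M + i)%N * ((M + i)%:R^-1 - M%:R^-1).
    rewrite mulr_suml -big_split; apply: eq_bigr => i _ /=.
    by rewrite addnC; ring.
  apply: le_trans (ler_normD _ _) _; apply: lerD.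
    by rewrite normrM normfV (ger0_norm (ltW M0)) ler_pM2r ?invr_gt0//.
  apply: le_trans (ler_norm_sum _ _ _) _.
  have -> : q%:R * D = \sum_(i < q) D by rewrite sumr_const card_ord mulr_natl.
  apply: ler_sum => i _.
  have i0 : 0 < (M + i)%:R :> R by rewrite ltr0n; lia.
  rewrite normrM -[leRHS]mul1r; apply: ler_pM => //; first by have := F2 (M + i)%N; lra.
  rewrite ler0_norm ?opprB; last by rewrite subr_le0 lef_pV2// ler_nat leq_addr.
  by rewrite lerB// lef_pV2// ler_nat leq_add2l ltnW.
have step : C / M%:R <= 2 * C / q%:R * (ln (M + q)%:R - ln M%:R).
  have h : q%:R / (2 * M%:R) <= ln (M + q)%:R - ln M%:R :> R.
    apply: le_trans (ln_diff_ge M0 MQ0).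
    have -> : 1 - M%:R / (M + q)%:R = q%:R / (M + q)%:R :> R.
      by rewrite MQ; field; rewrite -MQ gt_eqF.
    rewrite ler_pM2l// lef_pV2 ?posrE ?mulr_gt0// MQ.
    by have : q%:R <= M%:R :> R by [rewrite ler_nat]; lra.
  have -> : C / M%:R = 2 * C / q%:R * (q%:R / (2 * M%:R)) by field; rewrite !gt_eqF.
  by rewrite ler_wpM2l// divr_ge0// mulr_ge0.
have tail : q%:R / (M + q)%:R <= q%:R / M%:R :> R.
  by rewrite ler_pM2l// lef_pV2// ler_nat leq_addr.
move: ih first_block step tail; rewrite /D.
set a := 2 * C / q%:R; set l1 := ln _; set l2 := ln _; set l3 := ln _.
by lra.
Qed.

End Blocks.

(** * Oscillation of the partial sums near a point *)

Section NearPoint.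
Context {R : realType}.

Lemma harmonic_le_ln (N : nat) : (0 < N)%N ->
  \sum_(1 <= i < N.+1) i%:R^-1 <= 1 + ln N%:R :> R.
Proof.
elim: N => // N ih _; have [->|N0] := posnP N.
  by rewrite big_nat1 invr1 ln1 addr0.
rewrite big_nat_recr//=; have {}ih := ih N0.
have := @ln_diff_ge R N%:R N.+1%:R (ltac:(by rewrite ltr0n)) (ltac:(by rewrite ltr0n)).
have -> : 1 - N%:R / N.+1%:R = N.+1%:R^-1 :> R.
  by rewrite -natr1; field; rewrite natr1 pnatr_eq0.
by move=> h; apply: le_trans (lerD ih h) _; rewrite addrACA subrr addr0.
Qed.

Lemma sum_dvdn_inv (q N : nat) : (0 < q)%N ->
  \sum_(1 <= n < N.+1) (q %| n)%N%:R / n%:R =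
  (\sum_(1 <= i < (N %/ q).+1) i%:R^-1) / q%:R :> R.
Proof.
move=> q0; elim: N => [|N ih]; first by rewrite div0n !big_geq// mul0r.
rewrite big_nat_recr//= ih divnS//; case: (boolP (q %| N.+1)%N) => [/dvdnP[m hm]|_]; last first.
  by rewrite mul0r addr0 add0n.
have hm0 : (0 < m)%N by case: m hm.
have -> : (N %/ q)%N = m.-1.
  by have := divnS N q0; rewrite hm mulnK// dvdn_mull//= => ->; rewrite add1n.
rewrite add1n [in RHS]big_nat_recr//= prednK// mulrDl mul1r; congr (_ + _).
by rewrite hm natrM invfM.
Qed.

Lemma sum_dvdn_inv_le (q N : nat) : (0 < q)%N -> (0 < N)%N ->
  \sum_(1 <= n < N) (q %| n)%N%:R / n%:R <= (1 + ln N%:R) / q%:R :> R.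
Proof.
move=> q0; case: N => // N _; rewrite sum_dvdn_inv// ler_pM2r ?invr_gt0 ?ltr0n//.
have N1 : 0 <= ln N.+1%:R :> R by rewrite ln_ge0// ler1n.
have [->|h] := posnP (N %/ q)%N; first by rewrite big_geq//; lra.
apply: le_trans (harmonic_le_ln h) _; rewrite lerD2l ler_ln ?posrE ?ltr0n//.
by rewrite ler_nat (leq_trans (leq_div _ _)).
Qed.

(** Between [x] and a point at distance at most [h], all jumps coming from
    indices [n < N] with [2 h N ^ 2 < 1] sit at one rational [p / q], because
    distinct fractions are too far apart; only multiples of [q] contribute. *)
Lemma phi1_sum_low (x t h : R) (N : nat) : 0 < h -> `|t - x| <= h -> (0 < N)%N ->
  2 * N%:R ^+ 2 * h < 1 -> exists2 J : R,
  `|\sum_(1 <= n < N) (B1 (n%:R * t) / n%:R - B1 (n%:R * x) / n%:R)| <= N%:R * h + J &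
  J = 0 \/ exists (q : nat) (p : int), [/\ (0 < q < N)%N,
    `|p%:~R - q%:R * x| <= q%:R * h & J = (1 + ln N%:R) / q%:R].
Proof.
move=> h0 tx N0 hN.
pose T (n : nat) := `[< (0 < n < N)%N /\ exists p : int, `|p%:~R - n%:R * x| <= n%:R * h >].
have term n : (0 < n < N)%N ->
    `|B1 (n%:R * t) / n%:R - B1 (n%:R * x) / n%:R| <= h + (T n)%:R / n%:R.
  move=> nN; have n0 : 0 < n%:R :> R by rewrite ltr0n; lia.
  rewrite -mulrBl normrM normfV (ger0_norm (ltW n0)).
  rewrite -[h](mulfK (lt0r_neq0 n0)) -mulrDl ler_pM2r ?invr_gt0//.
  have nh : `|n%:R * t - n%:R * x| <= h * n%:R.
    by rewrite -mulrBr normrM ger0_norm// mulrC ler_pM2r.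
  have [Tn|Tn] := boolP (T n).
    apply: le_trans (ler_normB _ _) _.
    have := B1_bound (n%:R * t); have := B1_bound (n%:R * x).
    have : 0 <= h * n%:R by rewrite mulr_ge0 ?ltW.
    by rewrite /=; lra.
  rewrite B1_dist ?addr0// => z; apply: contraNN Tn => hz; apply/asboolP.
  by split=> //; exists z; apply: le_trans hz _; rewrite [leRHS]mulrC.
have sumh : \sum_(1 <= n < N) h <= N%:R * h.
  rewrite sumr_const_nat -[_ *+ (N - 1)]mulr_natl ler_pM2r// ler_nat; lia.
have [[q Tq]|noT] := pselect (exists q, T q); last first.
  exists 0; last by left.
  apply: le_trans (ler_norm_sum _ _ _) _; rewrite addr0; apply: le_trans sumh.
  apply: ler_sum_nat => n nN; apply: le_trans (term n nN) _.
  have -> : T n = false by apply: contra_notF noT => Tn; exists n.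
  by rewrite mul0r addr0.
case: (ex_minnP (ex_intro T q Tq)) => {q Tq} q /asboolP[qN [p hp]] qmin.
exists ((1 + ln N%:R) / q%:R); last by right; exists q, p.
apply: le_trans (ler_norm_sum _ _ _) _.
have q0 : (0 < q)%N by lia.
apply: (@le_trans _ _ (\sum_(1 <= n < N) (h + (q %| n)%N%:R / n%:R))); last first.
  by rewrite big_split /=; apply: lerD => //; exact: sum_dvdn_inv_le.
apply: ler_sum_nat => n nN; apply: le_trans (term n nN) _; rewrite lerD2l.
rewrite ler_pM2r ?invr_gt0 ?ltr0n; last by lia.
rewrite ler_nat; case: (boolP (T n)) => //= /asboolP[_ [r hr]].
have cross : p * n%:Z = r * q%:Z.
  have : `|(p * n%:Z - r * q%:Z)%:~R : R| < 1.
    have -> : (p * n%:Z - r * q%:Z)%:~R =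
        n%:R * (p%:~R - q%:R * x) - q%:R * (r%:~R - n%:R * x) :> R.
      by rewrite intrB !intrM; ring.
    apply: le_lt_trans (ler_normB _ _) _.
    rewrite !normrM !(@ger0_norm _ _%:R)//; apply: le_lt_trans hN.
    have nqN : n%:R * q%:R <= N%:R ^+ 2 :> R.
      by rewrite expr2; apply: ler_pM => //; rewrite ler_nat; lia.
    have : n%:R * q%:R * h <= N%:R ^+ 2 * h by rewrite ler_pM2r.
    have : n%:R * `|p%:~R - q%:R * x| <= n%:R * (q%:R * h) by rewrite ler_wpM2l.
    have : q%:R * `|r%:~R - n%:R * x| <= q%:R * (n%:R * h) by rewrite ler_wpM2l.
    by lra.
  by rewrite -intr_norm ltrz1; lia.
rewrite lt0b; apply/negPn/negP => qn.
(* the remainder of [n] modulo [q] would be a smaller denominator of [p / q] *)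
pose s := (n %% q)%N; pose u := r - p * (n %/ q)%N%:Z.
have s0 : (0 < s)%N by rewrite lt0n.
have sq : (s < q)%N by rewrite ltn_mod.
have su : p * s%:Z = u * q%:Z.
  have -> : s%:Z = n%:Z - (n %/ q)%N%:Z * q%:Z.
    by rewrite {1}(divn_eq n q) PoszD PoszM addrC addKr.
  by rewrite /u mulrBr cross; ring.
suff /qmin : T s by rewrite leqNgt sq.
apply/asboolP; split; first by lia.
exists u; have Q0 : 0 < q%:R :> R by rewrite ltr0n.
have e : q%:R * (u%:~R - s%:R * x) = s%:R * (p%:~R - q%:R * x).
  have : (p * s%:Z)%:~R = (u * q%:Z)%:~R :> R by rewrite su.
  by rewrite !intrM -!pmulrn; lra.
have : q%:R * `|u%:~R - s%:R * x| = s%:R * `|p%:~R - q%:R * x|.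
  by rewrite -{1}[q%:R](@ger0_norm R)// -{2}[s%:R](@ger0_norm R)// -!normrM e.
have : s%:R * `|p%:~R - q%:R * x| <= s%:R * (q%:R * h) by rewrite ler_wpM2l.
move=> h1 h2; rewrite -(ler_pM2l Q0) h2; lra.
Qed.

End NearPoint.

Section Oscillation.
Context {R : realType}.

Lemma phi1_sumDz (t : R) (z : int) N : phi1_sum (t + z%:~R) N = phi1_sum t N.
Proof.
apply: eq_big_nat => n _; congr (_ / _).
have -> : n%:R * (t + z%:~R) = n%:R * t + (n%:Z * z)%:~R :> R by rewrite intrM; ring.
by rewrite B1Dz.
Qed.

(** A denominator that approximates [x] to within [O(s)] is at least a large
    multiple of [log (1 / s)]. *)
Lemma subexp_log_denominator (x A B e : R) : subexp_irrational x -> 0 < A -> 0 < B ->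
  0 < e -> exists2 s0 : R, 0 < s0 & forall (s : R) (q : nat) (p : int),
  0 < s < s0 -> (0 < q)%N -> `|q%:R * x - p%:~R| <= B * s ->
  1 + ln (A / s ^+ 2) <= e * q%:R.
Proof.
move=> sx A0 B0 e0; have [c c0 hc] := sx (e / 6) (ltac:(clear -e0; lra)).
pose K1 := `|ln (B / c)|; pose K2 := `|ln A|.
exists (expR (- (2 * K1 + K2 + 1))); first exact: expR_gt0.
move=> s q p /andP[s0 sK] q0 hqp.
have KL : 2 * K1 + K2 + 1 < - ln s by rewrite ltrNr -ltr_expR lnK.
have h1 : expR (- (e / 6 * q%:R)) <= B / c * s.
  rewrite -(ler_pM2l c0); apply: le_trans (hc q p q0) _; apply: le_trans hqp _.
  by rewrite mulrA (mulrCA c) divff ?gt_eqF// mulr1.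
have Bc0 : 0 < B / c by rewrite divr_gt0.
have h2 : - (e / 6 * q%:R) <= ln (B / c) + ln s.
  by rewrite -lnM ?posrE// -ler_expR lnK// posrE mulr_gt0.
rewrite ln_div ?posrE ?exprn_gt0// lnXn// -[ln s *+ 2]mulr_natl.
have h3 : ln (B / c) <= K1 := ler_norm _.
have h4 : ln A <= K2 := ler_norm _.
have h5 : 0 <= K1 := normr_ge0 _; have h6 : 0 <= K2 := normr_ge0 _.
by move: (ln s) KL h2 h3 h4 h5 h6; clear => u; lra.
Qed.

(** The jumping indices are the multiples of one [q], whose total weight is
    [O((log M) / q)]; since [q] approximates [x] within [sqrt h], that is small. *)
Lemma phi1_sum_osc_low (x t h e : R) (M : nat) : 0 < h -> `|t - x| <= h ->
  (0 < M)%N -> M%:R * Num.sqrt h <= 2^-1 -> Num.sqrt h <= e / 2 ->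
  (forall (q : nat) (p : int), (0 < q)%N -> `|q%:R * x - p%:~R| <= Num.sqrt h ->
     1 + ln (h^-1) <= e / 4 * q%:R) ->
  `|\sum_(1 <= n < M) (B1 (n%:R * t) / n%:R - B1 (n%:R * x) / n%:R)| <= e / 2.
Proof.
move=> h0 tx M0; set s := Num.sqrt h => Ms se hlog.
have s0 : 0 < s by rewrite sqrtr_gt0.
have hs : h = s * s by rewrite -expr2 sqr_sqrtr// ltW.
have Mh : M%:R * h <= s / 2.
  by rewrite hs mulrA [leRHS]mulrC ler_pM2r.
have Ms0 : 0 <= M%:R * s by rewrite mulr_ge0// ltW.
have cond : 2 * M%:R ^+ 2 * h < 1.
  have -> : 2 * M%:R ^+ 2 * h = 2 * ((M%:R * s) * (M%:R * s)) by rewrite hs; ring.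
  have : M%:R * s * (M%:R * s) <= 2^-1 * 2^-1 by exact: ler_pM.
  by clear; lra.
have [J hJ JJ] := phi1_sum_low h0 tx M0 cond.
apply: le_trans hJ _; suff : J <= e / 4 by move: Mh se; clear; lra.
case: JJ => [->|[q [p [/andP[q0 qM] hp ->]]]]; first by move: s0 se; clear; lra.
have qh : q%:R * h <= s.
  have : q%:R * h <= M%:R * h by rewrite ler_pM2r// ler_nat ltnW.
  by move: Mh s0; clear; lra.
have hq := hlog q p q0 (ltac:(by rewrite distrC; exact: le_trans hp qh)).
rewrite ler_pdivrMr ?ltr0n//; apply: le_trans hq; rewrite lerD2l.
have M1 : 0 < M%:R :> R by rewrite ltr0n.
rewrite ler_ln ?posrE ?invr_gt0// -[leRHS]mul1r ler_pdivlMr//.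
have hMs : s * 1 <= s * M%:R by rewrite ler_pM2l// ler1n.
by move: Mh Ms hMs; clear; lra.
Qed.

Lemma phi1_sum_osc_high (y : R) (q : nat) (p : int) (I N : nat) : (0 < q)%N -> (0 < I)%N ->
  coprimez q p -> `|q%:R * y - p%:~R| <= 2 / q%:R -> (I * q <= N)%N ->
  `|\sum_(I * q <= n < N) B1 (n%:R * y) / n%:R| <= 12 / q%:R * ln N%:R + 2 / I%:R.
Proof.
move=> q0 I0 cqp hq IqN.
have Q0 : 0 < q%:R :> R by rewrite ltr0n.
have IR0 : 0 < I%:R :> R by rewrite ltr0n.
have blocks n : `|\sum_(r < q) B1 ((n + r)%:R * y)| <= 6.
  under eq_bigr do rewrite natrD mulrDl.
  exact: sum_B1_block q0 cqp hq.
have qIq : (q <= I * q <= N)%N by rewrite leq_pmull.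
have := block_sum_bound q0 (fun n => B1_bound (n%:R * y)) blocks qIq.
have NI : q%:R / (I * q)%:R = I%:R^-1 :> R by rewrite natrM; field; rewrite !gt_eqF.
rewrite !mulrBr NI (_ : 2 * 6 = 12); last by clear; lra.
have : 0 <= q%:R * N%:R^-1 :> R by rewrite mulr_ge0.
have : 0 <= 12 / q%:R * ln (I * q)%:R :> R.
  by rewrite mulr_ge0 ?divr_ge0// ln_ge0// ler1n muln_gt0 I0.
move: (12 / q%:R * _) (12 / q%:R * _) (q%:R / _) (I%:R^-1) => a b c d.
by clear; lra.
Qed.

(** Scales: with [s = sqrt h], a convergent denominator [q] of size at most
    [1 / (2 I s)] splits the sum at [I q]. Below, jumps come from one rational
    only; above, sums over blocks of length [q] are bounded, and [1 / I] and
    [log N / q] are small. *)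
Lemma phi1_sum_osc_unit (x A e : R) : unit_irrational x -> subexp_irrational x ->
  0 < A -> 0 < e -> exists2 h0 : R, 0 < h0 & forall h t : R, 0 < h < h0 ->
  `|t - x| <= h -> forall N : nat, N%:R <= A / h ->
  `|phi1_sum t N - phi1_sum x N| <= e.
Proof.
move=> ux sx A0 e0.
have [I I0 Ie] : exists2 I : nat, (0 < I)%N & 2 / I%:R <= e / 8.
  exists (Num.truncn (16 / e)).+1 => //.
  have := truncnS_gt (16 / e); rewrite ltr_pdivrMr// => h.
  by rewrite ler_pdivrMr ?ltr0n//; move: h; clear; lra.
have I1 : 1 <= I%:R :> R by rewrite ler1n.
have I20 : 0 < 2 * I%:R :> R by move: I1; clear; lra.
have A10 : 0 < A + 1 by move: A0; clear; lra.
have e960 : 0 < e / 96 by rewrite divr_gt0.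
have [s1 s10 hs1] := subexp_log_denominator sx A10 I20 e960.
pose s0 := Num.min (Num.min (2 * I%:R)^-1 (e / 2)) s1.
have s00 : 0 < s0 by rewrite !lt_min invr_gt0 I20 s10 divr_gt0.
exists (s0 ^+ 2) => [|h t /andP[h0 hs0] tx N hN]; first exact: exprn_gt0.
set s := Num.sqrt h; have s_gt0 : 0 < s by rewrite sqrtr_gt0.
have hs : h = s ^+ 2 by rewrite sqr_sqrtr// ltW.
have : s < s0 by rewrite -(ltr_pXn2r (n := 2)) ?nnegrE ?ltW// -hs.
rewrite !lt_min -andbA => /and3P[sI se ss1].
have {}hs1 q p : (0 < q)%N -> `|q%:R * x - p%:~R| <= 2 * I%:R * s ->
    1 + ln ((A + 1) / h) <= e / 96 * q%:R.
  by move=> q0 hq; rewrite hs; apply: hs1 hq => //; rewrite s_gt0.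
have {}sI : 2 * I%:R * s < 1 by move: sI; rewrite -[_^-1]mul1r ltr_pdivlMr// mulrC.
have Is : s <= I%:R * s by rewrite ler_peMl// ltW.
have hlt1 : h <= 1.
  rewrite hs expr_le1 ?ltW//; move: sI Is; clear; lra.
pose X := (2 * I%:R * s)^-1.
have Is0 : 0 < 2 * I%:R * s by rewrite mulr_gt0.
have X1 : 1 <= X by rewrite invf_ge1 ?Is0// ltW.
have XI : X^-1 = 2 * I%:R * s by rewrite invrK.
have [k [q [p [q0 qX cqp hqp /andP[bX _]]]]] := good_approx ux X1.
have Q0 : 0 < q%:R :> R by rewrite ltr0n.
have qIs : q%:R * (2 * I%:R * s) <= 1.
  by move: qX; rewrite /X -[_^-1]mul1r ler_pdivlMr.
have qs : q%:R * s <= 1.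
  apply: le_trans qIs; rewrite ler_pM2l//; move: Is s_gt0; clear; lra.
have logq : 1 + ln ((A + 1) / h) <= e / 96 * q%:R.
  by apply: (hs1 q p) => //; rewrite -XI hqp.
have lowbound (M : nat) : (0 < M <= I * q)%N ->
    `|\sum_(1 <= n < M) (B1 (n%:R * t) / n%:R - B1 (n%:R * x) / n%:R)| <= e / 2.
  move=> /andP[M0 MIq]; apply: (phi1_sum_osc_low h0 tx M0) => //.
  - have : M%:R * s <= (I * q)%:R * s by rewrite ler_pM2r// ler_nat.
    by rewrite natrM -/s; move: qIs; clear; lra.
  - exact: ltW.
  - move=> q' p' q'0 hq'; apply: (@le_trans _ _ (e / 96 * q'%:R)); last first.
      by rewrite ler_pM2r ?ltr0n//; move: e0; clear; lra.
    apply: le_trans (hs1 q' p' q'0 _); last first.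
      by apply: le_trans hq' _; rewrite -/s; move: Is s_gt0; clear; lra.
    rewrite lerD2l ler_ln ?posrE ?divr_gt0 ?invr_gt0//.
    rewrite -[leLHS]mul1r ler_pM2r ?invr_gt0//. by rewrite lerDr ltW.
have [short|long] := leqP N.+1 (I * q).
  rewrite /phi1_sum -sumrB.
  apply: le_trans (lowbound N.+1 _) _ => //.
  by move: e0; clear; lra.
have near (y : R) : `|y - x| <= h -> `|q%:R * y - p%:~R| <= 2 / q%:R.
  move=> yx; have -> : q%:R * y - p%:~R = q%:R * (y - x) + (q%:R * x - p%:~R) by ring.
  apply: le_trans (ler_normD _ _) _; rewrite hqp normrM (ger0_norm (ltW Q0)).
  have b1 : beta_pred k.+1 x <= q%:R^-1.
    by apply: le_trans bX _; rewrite lef_pV2 ?posrE// (lt_le_trans ltr01).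
  have b2 : q%:R * `|y - x| <= q%:R^-1.
    apply: (@le_trans _ _ (q%:R * h)); first by rewrite ler_pM2l.
    rewrite -[leRHS]mul1r ler_pdivlMr// hs.
    have -> : q%:R * s ^+ 2 * q%:R = (q%:R * s) * (q%:R * s) by ring.
    by rewrite mulr_ile1// mulr_ge0// ltW.
  by rewrite (_ : 2 / q%:R = q%:R^-1 + q%:R^-1) ?lerD//; clear; lra.
have high (y : R) : `|y - x| <= h ->
    `|\sum_(I * q <= n < N.+1) B1 (n%:R * y) / n%:R| <= e / 4.
  move=> yx; apply: le_trans (phi1_sum_osc_high q0 _ cqp (near y yx) _) _ => //.
    exact: ltnW.
  have lnN : 1 + ln N.+1%:R <= e / 96 * q%:R.
    apply: le_trans logq; rewrite lerD2l ler_ln ?posrE ?ltr0n ?divr_gt0//.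
    by rewrite -natr1 mulrDl lerD// mul1r invf_ge1.
  have : 12 / q%:R * ln N.+1%:R <= e / 8.
    rewrite mulrAC ler_pdivrMr//; move: lnN; move: (ln _) (q%:R : R) => u v; clear; lra.
  by move: Ie; move: (12 / q%:R * _) (2 / I%:R); clear => a b; lra.
have Iq0 : (1 <= I * q)%N by rewrite muln_gt0 I0.
have split_sum (y : R) : phi1_sum y N = \sum_(1 <= n < I * q) B1 (n%:R * y) / n%:R +
    \sum_(I * q <= n < N.+1) B1 (n%:R * y) / n%:R.
  by rewrite /phi1_sum (big_cat_nat Iq0 (leqW long)).
rewrite !split_sum opprD addrACA -(sumrB _ _ (fun n => B1 (n%:R * t) / n%:R)).
apply: le_trans (ler_normD _ _) _.
rewrite [leRHS](_ : e = e / 2 + (e / 4 + e / 4)); last by clear; lra.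
rewrite lerD ?lowbound ?Iq0 ?leqnn//; apply: le_trans (ler_normB _ _) _.
by rewrite lerD ?high// subrr normr0 ltW.
Qed.

Lemma phi1_sum_osc (x A e : R) : unit_irrational (frac_part x) ->
  subexp_irrational (frac_part x) ->
  0 < A -> 0 < e -> exists2 h0 : R, 0 < h0 & forall h t : R, 0 < h < h0 ->
  `|t - x| <= h -> forall N : nat, N%:R <= A / h ->
  `|phi1_sum t N - phi1_sum x N| <= e.
Proof.
move=> ux sx A0 e0; have [h0 h00 H] := phi1_sum_osc_unit ux sx A0 e0.
exists h0 => // h t hh tx N NA; rewrite -(phi1_sumDz t (- Num.floor x)).
rewrite -(phi1_sumDz x (- Num.floor x)) mulrNz; apply: H hh _ N NA.
by rewrite (_ : _ - frac_part x = t - x)// /frac_part; ring.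
Qed.

End Oscillation.

(** * Asymptotics of harmonic numbers and factorials *)

Section Asymptotics.
Context {R : realType}.

Lemma is_derive_ge0_homo (f df : R -> R) : (forall x, is_derive x (1 : R) f (df x)) ->
  (forall x, 0 <= x -> 0 <= df x) -> forall x, 0 <= x -> f 0 <= f x.
Proof.
move=> fd df0 x x0; have [c] := @MVT_segment R f df 0 x x0 (fun y _ => fd y)
  (derivable_within_continuous (fun y _ => @ex_derive _ _ _ _ _ _ _ (fd y))).
rewrite in_itv /= => /andP[c0 _] e; rewrite -subr_ge0 e subr0.
by rewrite mulr_ge0// df0.
Qed.

(** [u <= sinh u], in the variable [v = exp u]. *)
Lemma ln_le_sinh (v : R) : 1 <= v -> ln v <= (v - v^-1) / 2.
Proof.
move=> v1; have v0 : 0 < v by lra.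
pose f (u : R) := expR u * expR u - 2 * (u * expR u).
pose df (u : R) := 2 * expR u * (expR u - 1 - u).
have fd (u : R) : is_derive u (1 : R) f (df u).
  by rewrite /f; apply: is_derive_eq; rewrite /df !scaler1 /GRing.scale /=; ring.
have h : forall x : R, 0 <= x -> 0 <= df x.
  move=> x _; rewrite /df mulr_ge0 ?mulr_ge0 ?expR_ge0//.
  by have := expR_ge1Dx x; lra.
have := @is_derive_ge0_homo f df fd h (ln v) (ln_ge0 v1).
rewrite /f expR0 lnK// => {}h.
rewrite -(ler_pM2r v0) mulrAC mulrBl mulVf ?gt_eqF//; lra.
Qed.

Lemma ln_ge_pade (v : R) : 1 <= v -> 2 * (v - 1) / (v + 1) <= ln v.
Proof.
move=> v1; have v0 : 0 < v by lra.
pose f (u : R) := u * (expR u + 1) - 2 * expR u.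
pose df (u : R) := 1 + (u - 1) * expR u.
have fd (u : R) : is_derive u (1 : R) f (df u).
  by rewrite /f; apply: is_derive_eq; rewrite /df ?scaler1 /GRing.scale /=; ring.
have h : forall x : R, 0 <= x -> 0 <= df x.
  move=> x _; have h := expR_ge1Dx (- x); rewrite /df.
  have e0 := expR_gt0 x.
  have : expR x * (1 + - x) <= expR x * expR (- x) by rewrite ler_pM2l.
  by rewrite expRxMexpNx_1; lra.
have := @is_derive_ge0_homo f df fd h (ln v) (ln_ge0 v1).
rewrite /f expR0 lnK// ler_pdivrMr; lra.
Qed.

Lemma ln_step_le (y : R) : 0 < y -> ln (y + 1) - ln y <= (y^-1 + (y + 1)^-1) / 2.
Proof.
move=> y0; have y1 : 0 < y + 1 by lra.
rewrite -ln_div ?posrE//; apply: le_trans (ln_le_sinh _) _.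
  by rewrite ler_pdivlMr//; lra.
by rewrite le_eqVlt; apply/orP; left; apply/eqP; field; lra.
Qed.

Lemma ln_step_ge (y : R) : 0 < y -> 2 / (2 * y + 1) <= ln (y + 1) - ln y.
Proof.
move=> y0; have y1 : 0 < y + 1 by lra.
rewrite -ln_div ?posrE//; apply: le_trans (ln_ge_pade _).
  by rewrite le_eqVlt; apply/orP; left; apply/eqP; field; lra.
by rewrite ler_pdivlMr//; lra.
Qed.

Lemma adjacent_sequences (u v : nat -> R) : (forall n, u n <= u n.+1) ->
  (forall n, v n.+1 <= v n) -> (forall n, u n <= v n) ->
  exists l, forall n, u n <= l <= v n.
Proof.
move=> u1 v1 uv.
have homo_u : {homo u : m n / (m <= n)%N >-> m <= n} by apply: homo_leq => //; exact: le_trans.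
have homo_v : {homo v : m n / (m <= n)%N >-> n <= m}.
  by apply: (homo_leq (r := fun a b => b <= a)) => // y x z xy yz; exact: le_trans yz xy.
have uvmn m n : u m <= v n.
  apply: le_trans (homo_u _ _ (leq_maxl m n)) _.
  by apply: le_trans (uv _) _; exact: homo_v (leq_maxr m n).
have u0 : range u !=set0 by exists (u 0), 0.
exists (sup (range u)) => n; apply/andP; split.
  apply: ub_le_sup; last by exists n.
  by exists (v 0) => _ [m _ <-].
by apply: ge_sup => // _ [m _ <-].
Qed.

Lemma invr_sqr_le (n : nat) : (0 < n)%N -> (n.+1%:R ^+ 2)^-1 <= n%:R^-1 - n.+1%:R^-1 :> R.
Proof.
move=> n0; have N0 : 0 < n%:R :> R by rewrite ltr0n.
have -> : n%:R^-1 - n.+1%:R^-1 = (n%:R * (n%:R + 1))^-1 :> R.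
  by rewrite -natr1; field; rewrite gt_eqF//=; lra.
have N1 : 0 < n%:R + 1 :> R by lra.
rewrite -natr1 lef_pV2 ?posrE ?exprn_gt0 ?mulr_gt0//; nra.
Qed.

Lemma sum_inv_sqr_tail (d : nat -> R) : (forall m, (0 < m)%N -> `|d m| <= (m%:R ^+ 2)^-1) ->
  exists l, forall M, (0 < M)%N -> `|\sum_(1 <= m < M.+1) d m - l| <= M%:R^-1.
Proof.
move=> hd; pose S M := \sum_(1 <= m < M.+1) d m.
have step n : `|d n.+2| <= n.+1%:R^-1 - n.+2%:R^-1.
  by apply: le_trans (hd _ _) _ => //; exact: invr_sqr_le.
have SS n : S n.+2 = S n.+1 + d n.+2 by rewrite /S big_nat_recr.
have [l hl] := @adjacent_sequences (fun n => S n.+1 - n.+1%:R^-1) (fun n => S n.+1 + n.+1%:R^-1)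
  (ltac:(move=> n; have := step n; rewrite SS ler_norml; set a := n.+1%:R^-1; set b := n.+2%:R^-1; lra))
  (ltac:(move=> n; have := step n; rewrite SS ler_norml; set a := n.+1%:R^-1; set b := n.+2%:R^-1; lra))
  (ltac:(move=> n; rewrite lerD2l; apply: (@le_trans _ _ 0); rewrite ?oppr_le0 ?invr_ge0//)).
exists l => -[|M] // _; have := hl M; rewrite -/(S M.+1) ler_norml.
by set a := M.+1%:R^-1; lra.
Qed.

Definition harmonic_sum (n : nat) : R := \sum_(1 <= i < n.+1) i%:R^-1.

Definition log_factorial (n : nat) : R := \sum_(1 <= i < n.+1) ln i%:R.

Definition euler_defect (n : nat) : R := harmonic_sum n - ln n%:R - (2 * n%:R)^-1.

Definition stirling_defect (n : nat) : R :=
  log_factorial n - (n%:R + 2^-1) * ln n%:R + n%:R.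

Lemma harmonic_sumS n : harmonic_sum n.+1 = harmonic_sum n + n.+1%:R^-1.
Proof. by rewrite /harmonic_sum big_nat_recr. Qed.

Lemma log_factorialS n : log_factorial n.+1 = log_factorial n + ln n.+1%:R.
Proof. by rewrite /log_factorial big_nat_recr. Qed.

(** Euler's constant, with the error of the second-order expansion. *)
Lemma euler_defect_cvg : exists g, forall n, (0 < n)%N ->
  euler_defect n <= g <= euler_defect n + (8 * n%:R ^+ 2)^-1.
Proof.
have step n : 0 <= euler_defect n.+2 - euler_defect n.+1 <=
    (8 * n.+1%:R ^+ 2)^-1 - (8 * n.+2%:R ^+ 2)^-1.
  set y : R := n.+1%:R; have y0 : 0 < y by rewrite ltr0n.
  have yS : n.+2%:R = y + 1 by rewrite natr1.
  have -> : euler_defect n.+2 - euler_defect n.+1 =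
      (y^-1 + (y + 1)^-1) / 2 - (ln (y + 1) - ln y).
    rewrite /euler_defect harmonic_sumS yS -/y; field; lra.
  rewrite yS subr_ge0 ln_step_le//=.
  apply: le_trans (_ : (y^-1 + (y + 1)^-1) / 2 - 2 / (2 * y + 1) <= _).
    by rewrite lerB// ln_step_ge.
  rewrite -subr_ge0.
  have -> : (8 * y ^+ 2)^-1 - (8 * (y + 1) ^+ 2)^-1 - ((y^-1 + (y + 1)^-1) / 2 - 2 / (2 * y + 1)) =
    (8 * y ^+ 2 * (y + 1) ^+ 2 * (2 * y + 1))^-1 by field; lra.
  by rewrite invr_ge0 !mulr_ge0 ?exprn_ge0//; lra.
have [g hg] := @adjacent_sequences (fun n => euler_defect n.+1)
  (fun n => euler_defect n.+1 + (8 * n.+1%:R ^+ 2)^-1)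
  (ltac:(move=> n; have := step n; lra))
  (ltac:(move=> n; have := step n; set a := (_ ^-1); set b := (_^-1); lra))
  (ltac:(move=> n; rewrite lerDl invr_ge0 mulr_ge0 ?exprn_ge0//)).
by exists g => -[|n] // _; exact: hg.
Qed.

Lemma stirling_defect_cvg : exists s, forall n, (0 < n)%N ->
  stirling_defect n - (4 * n%:R)^-1 <= s <= stirling_defect n.
Proof.
have step n : (4 * n.+2%:R)^-1 - (4 * n.+1%:R)^-1 <=
    stirling_defect n.+2 - stirling_defect n.+1 <= 0.
  set y : R := n.+1%:R; have y0 : 0 < y by rewrite ltr0n.
  have yS : n.+2%:R = y + 1 by rewrite natr1.
  have -> : stirling_defect n.+2 - stirling_defect n.+1 =
      1 - (y + 2^-1) * (ln (y + 1) - ln y).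
    by rewrite /stirling_defect log_factorialS yS -/y; ring.
  have y2 : 0 < y + 2^-1 by lra.
  rewrite yS; apply/andP; split.
    have : (y + 2^-1) * (ln (y + 1) - ln y) <= (y + 2^-1) * ((y^-1 + (y + 1)^-1) / 2).
      by rewrite ler_pM2l// ln_step_le.
    have -> : (y + 2^-1) * ((y^-1 + (y + 1)^-1) / 2) = 1 + ((4 * y)^-1 - (4 * (y + 1))^-1).
      by field; lra.
    by set a := (_ ^-1); set b := (_^-1); lra.
  have : (y + 2^-1) * (2 / (2 * y + 1)) <= (y + 2^-1) * (ln (y + 1) - ln y).
    by rewrite ler_pM2l// ln_step_ge.
  have -> : (y + 2^-1) * (2 / (2 * y + 1)) = 1 by field; lra.
  by lra.
have [s hs] := @adjacent_sequences (fun n => stirling_defect n.+1 - (4 * n.+1%:R)^-1)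
  (fun n => stirling_defect n.+1)
  (ltac:(move=> n; have := step n; set a := (_ ^-1); set b := (_^-1); lra))
  (ltac:(move=> n; have := step n; lra))
  (ltac:(move=> n; rewrite gerDl oppr_le0 invr_ge0 mulr_ge0//)).
by exists s => -[|n] // _; exact: hs.
Qed.

End Asymptotics.

(** * The reciprocity formula and convergence at Wilton numbers *)

Section Reciprocity.
Context {R : realType}.
Implicit Types x : R.

Lemma truncn_natP (y : R) : 0 <= y -> (forall k : nat, y != k%:R) ->
  exists2 f, 0 < f < 1 & y = (Num.truncn y)%:R + f.
Proof.
move=> y0 yN; exists (y - (Num.truncn y)%:R); last by ring.
have /andP[h1 h2] := truncn_itv y0; rewrite -natr1 in h2.
rewrite subr_gt0 lt_neqAle eq_sym yN h1 /=; lra.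
Qed.

Lemma B1_truncn (y : R) : 0 <= y -> (forall k : nat, y != k%:R) ->
  B1 y = y - (Num.truncn y)%:R - 2^-1.
Proof.
move=> y0 yN; have [f f01 e] := truncn_natP y0 yN.
have -> : B1 y = f - 2^-1 by rewrite {1}e -(B1_eq (Num.truncn y)%:Z f01).
by move: e; move: (Num.truncn y)%:R => k ->; ring.
Qed.

Lemma irrational_mul_nat x (n : nat) : unit_irrational x -> (0 < n)%N ->
  forall k : nat, n%:R * x != k%:R.
Proof. by move=> [_ irr] n0 k; exact: (irrational_mulrn k%:Z irr n0). Qed.

Lemma irrational_div_nat x (m : nat) : unit_irrational x -> (0 < m)%N ->
  forall k : nat, m%:R * x^-1 != k%:R.
Proof.
move=> ux m0 k; have [/andP[x0 x1] irr] := ux.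
apply/eqP => e; have e2 : m%:R = k%:R * x by rewrite -e mulfVK// gt_eqF.
have k0 : (0 < k)%N.
  rewrite lt0n; apply/eqP => k0; move/eqP : e2; rewrite k0 mul0r pnatr_eq0.
  by rewrite eqn0Ngt m0.
by have := irrational_mul_nat ux k0 m; rewrite e2 eqxx.
Qed.

Lemma harmonic_sum_diff (k N : nat) : (k <= N)%N ->
  harmonic_sum N - harmonic_sum k = \sum_(1 <= n < N.+1) (k < n)%N%:R / n%:R :> R.
Proof.
move=> kN; rewrite /harmonic_sum [\sum_(1 <= i < N.+1) i%:R^-1](big_cat_nat (n := k.+1))//=.
rewrite [RHS](big_cat_nat (n := k.+1))//= [X in _ = X + _]big1_seq; last first.
  move=> n; rewrite mem_index_iota => /andP[_ /andP[_ nk]].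
  by rewrite ltnNge -ltnS nk mul0r.
rewrite add0r addrAC subrr add0r; apply: eq_big_nat => n /andP[kn _].
by rewrite kn mul1r.
Qed.

(** Counting the lattice points [(n, m)] with [n <= N] and [m <= n x] by columns
    and by rows, with weight [1 / n]. *)
Lemma sum_truncn_exchange x (N : nat) : unit_irrational x ->
  \sum_(1 <= n < N.+1) (Num.truncn (n%:R * x))%:R / n%:R =
  \sum_(1 <= m < (Num.truncn (N%:R * x)).+1)
     (harmonic_sum N - harmonic_sum (Num.truncn (m%:R * x^-1))) :> R.
Proof.
move=> ux; have [/andP[x0 x1] irr] := ux.
set M := Num.truncn (N%:R * x).
transitivity (\sum_(1 <= n < N.+1) \sum_(1 <= m < M.+1)
    (m%:R <= n%:R * x :> R)%R%:R / n%:R : R).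
  apply: eq_big_nat => n /andP[n1 nN]; rewrite -mulr_suml; congr (_ / _).
  have nx0 : 0 <= n%:R * x by rewrite mulr_ge0// ltW.
  rewrite -natr_sum; congr (_%:R).
  have kM : (Num.truncn (n%:R * x) <= M)%N.
    by apply: le_truncn; rewrite ler_pM2r// ler_nat.
  rewrite (big_cat_nat (n := (Num.truncn (n%:R * x)).+1))//=.
  rewrite (eq_big_nat _ _ (F2 := fun=> 1%N)); last first.
    by move=> m /andP[_ mk]; rewrite -truncn_ge_nat// -ltnS mk.
  rewrite [X in (_ + X)%N]big1_seq; last first.
    move=> m; rewrite mem_index_iota => /andP[_ /andP[mk _]].
    by rewrite -truncn_ge_nat// leqNgt mk.
  by rewrite sum_nat_const_nat muln1 subn1 addn0.
rewrite exchange_big_nat/=; apply: eq_big_nat => m /andP[m1 mM].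
have mx0 : 0 <= m%:R * x^-1 by rewrite mulr_ge0// invr_ge0 ltW.
rewrite harmonic_sum_diff.
  apply: eq_big_nat => n /andP[n1 nN]; congr (_%:R / _); congr nat_of_bool.
  rewrite truncn_lt_nat// lt_neqAle irrational_div_nat//=.
  by rewrite ler_pdivrMr.
rewrite -ltnS truncn_lt_nat//; apply: le_lt_trans (_ : N%:R < _); last by rewrite ltr_nat.
by rewrite ler_pdivrMr// -truncn_ge_nat// mulr_ge0// ltW.
Qed.

(** [H_[y] + B_1(y) / y - log y]: the sawtooth term removes the jumps of the
    harmonic sum, which makes the distance to Euler's constant [O(1 / y ^ 2)],
    summable over [y = m / x]. *)
Definition smoothed_defect (y : R) : R :=
  harmonic_sum (Num.truncn y) + B1 y / y - ln y.

Lemma smoothed_defect_bound : exists g : R,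
  (forall n, (0 < n)%N -> euler_defect n <= g <= euler_defect n + (8 * n%:R ^+ 2)^-1) /\
  (forall (y : R) (m : nat), (0 < m)%N -> m%:R <= y -> (forall k : nat, y != k%:R) ->
     `|smoothed_defect y - g| <= (m%:R ^+ 2)^-1).
Proof.
have [g hg] := @euler_defect_cvg R; exists g; split=> // y m m0 my yN.
have M0 : 0 < m%:R :> R by rewrite ltr0n.
have y0 : 0 <= y by lra.
have [f f01 e] := truncn_natP y0 yN.
have mn : (m <= Num.truncn y)%N by rewrite truncn_ge_nat.
rewrite /smoothed_defect B1_truncn//; set n := Num.truncn y in e mn *.
have n0 : (0 < n)%N by exact: leq_trans mn.
have {hg} := hg n n0; rewrite /euler_defect; set H := harmonic_sum n.
set a : R := n%:R in e *; have a1 : 1 <= a by rewrite ler1n.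
have a0 : 0 < a by lra.
have ma : m%:R <= a by rewrite ler_nat.
have yp : 0 < y by lra.
move=> /andP[g1 g2].
have l1 : 1 - a / y <= ln y - ln a by exact: ln_diff_ge.
have l2 : ln y - ln a <= y / a - 1.
  by have := ln_diff_ge yp a0; lra.
have -> : y - a - 2^-1 = f - 2^-1 by lra.
have hm : (a ^+ 2)^-1 <= (m%:R ^+ 2)^-1.
  by rewrite lef_pV2 ?posrE ?exprn_gt0//; apply: lerXn2r; rewrite // nnegrE ltW.
apply: le_trans hm.
have i1 : (8 * a ^+ 2)^-1 = (a ^+ 2)^-1 / 8 by field; lra.
have i2 : 0 <= (a * y)^-1 <= (a ^+ 2)^-1.
  apply/andP; split; first by rewrite invr_ge0 mulr_ge0// ltW.
  by rewrite lef_pV2 ?posrE ?mulr_gt0 ?exprn_gt0// expr2 ler_pM2l//; lra.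
have fy : f = y - a by lra.
have e1 : 1 - a / y = f / y by rewrite fy; field; lra.
have e2 : (f - 2^-1) / y = f / y - (2 * y)^-1 by field; lra.
have e3 : y / a - 1 = f / a by rewrite fy; field; lra.
have e4 : (2 * a)^-1 - (2 * y)^-1 = f * (a * y)^-1 / 2.
  by rewrite fy; field; lra.
have e5 : f / a - f / y = f * (f * (a * y)^-1).
  by rewrite fy; field; lra.
have /andP[f0 f1] := f01; have /andP[i20 i21] := i2.
have q1 : f * (a * y)^-1 <= (a ^+ 2)^-1.
  by apply: le_trans i21; rewrite ler_piMl// ltW.
have q0 : 0 <= f * (a * y)^-1 by rewrite mulr_ge0// ltW.
have q2 : f * (f * (a * y)^-1) <= f * (a * y)^-1 by rewrite ler_piMl// ltW.
have q3 : 0 <= f * (f * (a * y)^-1) by rewrite mulr_ge0// ltW.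
have q4 : f * (f * (a * y)^-1) - f * (a * y)^-1 / 2 <= (a ^+ 2)^-1 / 2 by lra.
rewrite e2; move: g1 g2 l1 l2; rewrite i1 e1 e3.
rewrite ler_norml; move: q0 q1 q2 q3 q4 e4 e5.
move: (f * (f * (a * y)^-1)) (f * (a * y)^-1) ((a ^+ 2)^-1) (f / a) (f / y) ((2 * a)^-1) ((2 * y)^-1) => z1 z2 z3 z4 z5 z6 z7.
by clear; move: (ln y) (ln a) => w1 w2; lra.
Qed.

End Reciprocity.

Section ReciprocityAsymptotics.
Context {R : realType}.
Implicit Types x : R.

(** The two sides of the functional equation under [x -> 1 / x]; the second sum runs
    over the same lattice points, counted by rows. *)
Definition reciprocity_sum x (N : nat) : R :=
  phi1_sum x N + x * phi1_sum x^-1 (Num.truncn (N%:R * x)).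

Lemma phi1_sum_truncn x (N : nat) : unit_irrational x ->
  phi1_sum x N = N%:R * x - harmonic_sum N / 2 -
    \sum_(1 <= n < N.+1) (Num.truncn (n%:R * x))%:R / n%:R.
Proof.
move=> ux; have [/andP[x0 x1] irr] := ux.
have -> : N%:R * x = \sum_(1 <= n < N.+1) x.
  by rewrite sumr_const_nat subn1 mulr_natl.
rewrite /harmonic_sum mulr_suml -!sumrB; apply: eq_big_nat => n /andP[n1 _].
have n0 : 0 < n%:R :> R by rewrite ltr0n.
rewrite B1_truncn; [|by rewrite mulr_ge0// ltW|exact: irrational_mul_nat].
by field; lra.
Qed.

Lemma reciprocity_sum_expansion x (N : nat) : unit_irrational x ->
  let M := Num.truncn (N%:R * x) in (0 < M)%N -> (0 < N)%N ->
  reciprocity_sum x N =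
    (N%:R * x - M%:R) + (M%:R + 2^-1) * (ln M%:R - ln (N%:R * x)) + ln x / 2
    - (M%:R + 2^-1) / (2 * N%:R) - euler_defect N / 2 + stirling_defect M
    + \sum_(1 <= m < M.+1) (smoothed_defect (m%:R * x^-1) - euler_defect N).
Proof.
move=> ux M M0 N0; have [/andP[x0 x1] irr] := ux.
have NR : 0 < N%:R :> R by rewrite ltr0n.
rewrite /reciprocity_sum phi1_sum_truncn// sum_truncn_exchange// -/M.
have key : x * phi1_sum x^-1 M -
    \sum_(1 <= m < M.+1) (harmonic_sum N - harmonic_sum (Num.truncn (m%:R * x^-1))) =
    \sum_(1 <= m < M.+1) (smoothed_defect (m%:R * x^-1) - euler_defect N)
    + log_factorial M - M%:R * (ln x + ln N%:R + (2 * N%:R)^-1).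
  have -> : M%:R * (ln x + ln N%:R + (2 * N%:R)^-1) =
      \sum_(1 <= m < M.+1) (ln x + ln N%:R + (2 * N%:R)^-1).
    by rewrite sumr_const_nat subn1 -[RHS]mulr_natl.
  rewrite /phi1_sum mulr_sumr /log_factorial -big_split /= -!sumrB.
  apply: eq_big_nat => m /andP[m1 _]; have m0 : 0 < m%:R :> R by rewrite ltr0n.
  rewrite /smoothed_defect /euler_defect lnM ?posrE ?invr_gt0// lnV ?posrE//.
  by field; rewrite !gt_eqF.
rewrite addrAC -addrA [X in _ + X](_ : _ = \sum_(1 <= m < M.+1) (smoothed_defect (m%:R * x^-1) - euler_defect N)
    + log_factorial M - M%:R * (ln x + ln N%:R + (2 * N%:R)^-1)); last first.
  by rewrite -key; ring.
rewrite lnM ?posrE// /stirling_defect /euler_defect.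
by set S := bigop _ _ _; field; rewrite gt_eqF.
Qed.

(** Euler-Maclaurin turns the double counting into the approximate functional
    equation [phi(x) + x phi(1/x) = - log(1/x) / 2 + O(1)] of the partial sums,
    with a limit as [N] grows. *)
Lemma reciprocity_asymptotics : exists2 C : R, 0 <= C & forall x, unit_irrational x ->
  exists2 L, `|L + ln x^-1 / 2| <= C & forall N : nat,
    (0 < Num.truncn (N%:R * x))%N ->
    `|reciprocity_sum x N - L| <= C / (Num.truncn (N%:R * x))%:R.
Proof.
have [g [hg hsd]] := @smoothed_defect_bound R; have [s hs] := @stirling_defect_cvg R.
exists (`|g| + `|s| + 6); first by rewrite !addr_ge0.
move=> x ux; have [/andP[x0 x1] irr] := ux.
pose d m := smoothed_defect (m%:R * x^-1) - g.
have hd m : (0 < m)%N -> `|d m| <= (m%:R ^+ 2)^-1.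
  move=> m0; apply: hsd => //; last exact: irrational_div_nat.
  by rewrite ler_peMr// invf_ge1// ltW.
have [l hl] := sum_inv_sqr_tail hd.
have l2 : `|l| <= 2.
  have := hl 1 isT; rewrite big_nat1 invr1 => h1.
  have := hd 1 isT; rewrite expr1n invr1 => h2.
  rewrite -[l](subKr (d 1)) (le_trans (ler_normB _ _))//.
  by move: h1 h2; clear; lra.
exists (ln x / 2 - x / 2 - g / 2 + s + l).
  rewrite lnV ?posrE//; have := ler_norm g; have := ler_norm s.
  have := ler_norm (- g); have := ler_norm (- s); rewrite !normrN.
  move: l2; rewrite !ler_norml => /andP[]; move: x0 x1; clear.
  move: (ln x) => u ? ? ? ? ? ? ? ?; apply/andP; split; lra.
move=> N M0; set M := Num.truncn _ in M0 *.
have N0 : (0 < N)%N by rewrite lt0n; apply: contraTneq M0 => N0; rewrite /M N0 mul0r truncn0.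
have NR : 0 < N%:R :> R by rewrite ltr0n.
have Nx0 : 0 < N%:R * x by rewrite mulr_gt0.
have /andP[MN NM] := truncn_itv (ltW Nx0); rewrite -/M in MN NM.
rewrite -natr1 in NM.
have MR : 1 <= M%:R :> R by rewrite ler1n.
rewrite (reciprocity_sum_expansion ux M0 N0) -/M.
have MR0 : 0 < M%:R :> R by rewrite ltr0n.
have NxN : N%:R * x <= N%:R by rewrite ler_piMr// ltW.
have MleN : M%:R <= N%:R :> R by move: MN NxN; clear; lra.
have iNM : N%:R^-1 <= M%:R^-1 :> R by rewrite lef_pV2.
have iM0 : 0 <= M%:R^-1 :> R by rewrite invr_ge0.
have iN0 : 0 <= N%:R^-1 :> R by rewrite invr_ge0.
have /andP[s1 s2] := hs M M0; have /andP[g1 g2] := hg N N0.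
have -> : \sum_(1 <= m < M.+1) (smoothed_defect (m%:R * x^-1) - euler_defect N) =
    \sum_(1 <= m < M.+1) d m + M%:R * (g - euler_defect N).
  have -> : M%:R * (g - euler_defect N) = \sum_(1 <= m < M.+1) (g - euler_defect N).
    by rewrite sumr_const_nat subn1 mulr_natl.
  rewrite -big_split; apply: eq_big_nat => m _ /=.
  by rewrite /d addrA subrK.
have hlM := hl M M0; set S := \sum_(1 <= m < M.+1) d m in hlM *.
have l1 : ln (N%:R * x) - ln M%:R <= N%:R * x / M%:R - 1.
  by have := ln_diff_ge Nx0 MR0; lra.
have l3 : 1 - M%:R / (N%:R * x) <= ln (N%:R * x) - ln M%:R by exact: ln_diff_ge.
set f := N%:R * x - M%:R; set D := ln (N%:R * x) - ln M%:R in l1 l3.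
have f01 : 0 <= f <= 1 by rewrite /f; move: MN NM; clear; lra.
have /andP[f0 f1] := f01.
have NxE : N%:R * x = M%:R + f by rewrite /f; ring.
have t1 : `|f + (M%:R + 2^-1) * - D| <= M%:R^-1.
  have e1 : N%:R * x / M%:R - 1 = f / M%:R by rewrite NxE; field; lra.
  have e3 : 1 - M%:R / (N%:R * x) = f / (M%:R + f) by rewrite NxE; field; lra.
  rewrite e1 in l1; rewrite e3 in l3.
  have Mf0 : 0 < M%:R + f by rewrite -NxE.
  have M20 : 0 <= M%:R + 2^-1 :> R by lra.
  have u1 : (M%:R + 2^-1) * D <= (M%:R + 2^-1) * (f / M%:R) by rewrite ler_wpM2l.
  have u3 : (M%:R + 2^-1) * (f / (M%:R + f)) <= (M%:R + 2^-1) * D by rewrite ler_wpM2l.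
  have v1 : (M%:R + 2^-1) * (f / M%:R) = f + f / M%:R / 2 by field; lra.
  have v3 : (M%:R + 2^-1) * (f / (M%:R + f)) = f - f * ((f - 2^-1) / (M%:R + f)) by field; lra.
  have w1 : f / M%:R <= M%:R^-1 by rewrite ler_piMl.
  have w2 : 0 <= f / M%:R by rewrite divr_ge0.
  have w3 : f * ((f - 2^-1) / (M%:R + f)) <= M%:R^-1.
    have z1 : (M%:R + f)^-1 <= M%:R^-1 by rewrite lef_pV2 ?posrE// lerDl.
    have z0 : 0 <= (M%:R + f)^-1 by rewrite invr_ge0 ltW.
    rewrite mulrA; apply: le_trans z1; rewrite -[leRHS]mul1r ler_wpM2r//.
    apply: (@le_trans _ _ f) => //; rewrite ler_piMr//; move: f1; clear; lra.
  rewrite v1 in u1; rewrite v3 in u3; rewrite mulrN ler_norml.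
  move: u1 u3 w1 w2 w3; move: ((_ + _) * D) (f / M%:R) (f * (_ / _)) M%:R^-1.
  by clear => a1 a2 a3 a4; lra.
have t2 : `|x / 2 - (M%:R + 2^-1) / (2 * N%:R)| <= M%:R^-1.
  have -> : x / 2 - (M%:R + 2^-1) / (2 * N%:R) = (f - 2^-1) / 2 * N%:R^-1.
    by rewrite /f; field; lra.
  rewrite normrM (ger0_norm iN0); apply: le_trans iNM; rewrite ler_piMl//.
  by rewrite ler_norml; move: f0 f1; clear; lra.
have n8 : (8 * N%:R ^+ 2)^-1 <= N%:R^-1 :> R.
  rewrite lef_pV2 ?posrE ?mulr_gt0 ?exprn_gt0// expr2.
  have : N%:R * 1 <= N%:R * N%:R :> R by rewrite ler_pM2l// ler1n.
  by move: NR; clear; lra.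
have t3 : `|(g - euler_defect N) / 2| <= M%:R^-1.
  move: g1 g2 n8 iNM; move: (8 * _)^-1 N%:R^-1 M%:R^-1 => a b c.
  by rewrite ler_norml; clear; lra.
have t4 : `|stirling_defect M - s| <= M%:R^-1.
  have i4 : (4 * M%:R)^-1 <= M%:R^-1 :> R.
    by rewrite lef_pV2 ?posrE ?mulr_gt0//; move: MR0; clear; lra.
  move: s1 s2 i4 iM0; move: (4 * _)^-1 M%:R^-1 => a b.
  by rewrite ler_norml; clear; lra.
have t5 : `|M%:R * (g - euler_defect N)| <= M%:R^-1.
  have h0 : 0 <= g - euler_defect N by rewrite subr_ge0.
  rewrite ger0_norm; last by rewrite mulr_ge0.
  apply: (@le_trans _ _ (N%:R * (8 * N%:R ^+ 2)^-1)).
    by apply: ler_pM => //; move: g2; clear; lra.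
  apply: le_trans iNM; rewrite (_ : _ * _ = N%:R^-1 / 8); last by field; lra.
  by move: iN0; move: N%:R^-1 => a; clear; lra.
have -> : f + (M%:R + 2^-1) * (ln M%:R - ln (N%:R * x)) + ln x / 2
    - (M%:R + 2^-1) / (2 * N%:R) - euler_defect N / 2 + stirling_defect M
    + (S + M%:R * (g - euler_defect N)) - (ln x / 2 - x / 2 - g / 2 + s + l) =
    (f + (M%:R + 2^-1) * - D) + (x / 2 - (M%:R + 2^-1) / (2 * N%:R)) +
    (g - euler_defect N) / 2 + (stirling_defect M - s) + (S - l) +
    M%:R * (g - euler_defect N).
  by rewrite /D; field; lra.
have bound : (6 : R) * M%:R^-1 <= (`|g| + `|s| + 6) / M%:R.
  by rewrite ler_wpM2r// lerDr addr_ge0.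
apply: le_trans bound.
have -> : 6 * M%:R^-1 = M%:R^-1 + M%:R^-1 + M%:R^-1 + M%:R^-1 + M%:R^-1 + M%:R^-1 :> R.
  by ring.
by do 5 (apply: le_trans (ler_normD _ _) _; apply: lerD => //).
Qed.

Lemma phi1_sum_gauss x (N : nat) : unit_irrational x ->
  phi1_sum x N = reciprocity_sum x N - x * phi1_sum (gauss_map x) (Num.truncn (N%:R * x)).
Proof.
move=> ux; rewrite /reciprocity_sum.
have -> : phi1_sum x^-1 (Num.truncn (N%:R * x)) = phi1_sum (gauss_map x) (Num.truncn (N%:R * x)).
  by rewrite /gauss_map /frac_part -mulrNz phi1_sumDz.
by rewrite addrK.
Qed.

(** The functional equation, iterated until the number of terms is exhausted,
    compares the partial sum at [alpha_k] with a block of the Wilton series. *)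
Lemma phi1_sum_wilton_block : exists2 C : R, 0 <= C & forall x, unit_irrational x ->
  forall N k : nat, exists2 K : nat, (k <= K)%N &
  `|(-1) ^+ k * beta_pred k x * phi1_sum (alpha k x) N +
    (\sum_(k <= j < K) wilton_term x j) / 2| <=
  C * \sum_(k <= j < K.+1) beta_pred j x + `|wilton_term x K|.
Proof.
have [C C0 hC] := reciprocity_asymptotics.
exists (C + C + 2) => [|x ux]; first by rewrite !addr_ge0.
have CC : C <= C + C + 2 by move: C0; clear; lra.
move=> N; have [n] := ubnP N; elim: n N => // n ih N Nn k.
have uk := alpha_unit k ux; have /andP[a0 a1] := alpha_itv k ux.
have bk := beta_pred_gt0 k ux.
have lna : 0 <= ln (alpha k x)^-1 by rewrite ln_ge0// invf_ge1// ltW.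
have [M0|M0] := posnP (Num.truncn (N%:R * alpha k x)).
  exists k => //; rewrite big_geq// mul0r addr0 big_nat1.
  have hS : `|phi1_sum (alpha k x) N| <= 2 + ln (alpha k x)^-1.
    have Nx0 : 0 <= N%:R * alpha k x by rewrite mulr_ge0// ltW.
    have Na1 : N%:R * alpha k x < 1 by have /andP[_] := truncn_itv Nx0; rewrite M0.
    rewrite (phi1_sum_truncn _ uk) sum_truncn_exchange// M0 big_geq// subr0.
    have hN : harmonic_sum N <= 1 + ln (alpha k x)^-1.
      have [->|N0] := posnP N; first by rewrite /harmonic_sum big_geq// addr_ge0.
      apply: le_trans (harmonic_le_ln N0) _; rewrite lerD2l.
      have NR : 0 < N%:R :> R by rewrite ltr0n.
      rewrite ler_ln ?posrE ?invr_gt0// -[leRHS]mul1r ler_pdivlMr//; exact: ltW.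
    have hN0 : 0 <= harmonic_sum N :> R by rewrite sumr_ge0// => i _; rewrite invr_ge0.
    rewrite ler_norml; move: Na1 Nx0 hN hN0 lna.
    move: (N%:R * _) (harmonic_sum N) (ln _); clear => u v w ? ? ? ? ?.
    by apply/andP; split; lra.
  rewrite /wilton_term /gamma_ !normrM normrX normrN1 expr1n !mul1r.
  rewrite (gtr0_norm bk) (ger0_norm lna).
  apply: le_trans (ler_wpM2l (ltW bk) hS) _.
  have : 0 <= C * beta_pred k x by rewrite mulr_ge0// ltW.
  by rewrite mulrDr !mulrDl; move: (_ * ln _) => u; clear; lra.
set M := Num.truncn _ in M0.
have Nx0 : 0 <= N%:R * alpha k x by rewrite mulr_ge0// ltW.
have MN : (M < N)%N.
  have N0 : 0 < N%:R :> R.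
    by rewrite ltr0n lt0n; apply: contraTneq M0 => N0; rewrite /M N0 mul0r truncn0.
  rewrite -(ltr_nat R); have /andP[MN _] := truncn_itv Nx0; apply: le_lt_trans MN _.
  by rewrite -[ltRHS]mulr1 ltr_pM2l.
have [K kK hK] := ih M (leq_trans MN Nn) k.+1.
exists K; first exact: ltnW.
have [L hL hE] := hC _ uk; have {}hE := hE N M0; rewrite -/M in hE.
have E1 : `|reciprocity_sum (alpha k x) N + ln (alpha k x)^-1 / 2| <= C + C.
  have -> : reciprocity_sum (alpha k x) N + ln (alpha k x)^-1 / 2 =
    (reciprocity_sum (alpha k x) N - L) + (L + ln (alpha k x)^-1 / 2) by ring.
  apply: le_trans (ler_normD _ _) _; apply: lerD => //.
  by apply: le_trans hE _; rewrite ler_piMr// invf_le1 ?ltr0n// ler1n.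
rewrite big_ltn//= [\sum_(k <= j < K.+1) _]big_ltn; last by rewrite ltnS ltnW.
rewrite (phi1_sum_gauss N uk) -/M -alphaS.
have -> : (-1) ^+ k * beta_pred k x * (reciprocity_sum (alpha k x) N - alpha k x * phi1_sum (alpha k.+1 x) M) +
    (wilton_term x k + \sum_(k.+1 <= j < K) wilton_term x j) / 2 =
  (-1) ^+ k * beta_pred k x * (reciprocity_sum (alpha k x) N + ln (alpha k x)^-1 / 2) +
  ((-1) ^+ k.+1 * beta_pred k.+1 x * phi1_sum (alpha k.+1 x) M + (\sum_(k.+1 <= j < K) wilton_term x j) / 2).
  by rewrite beta_predS exprS {1}/wilton_term /gamma_; ring.
apply: le_trans (ler_normD _ _) _; rewrite [in leRHS]mulrDr -[leRHS]addrA.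
apply: lerD => //.
rewrite !normrM normrX normrN1 expr1n mul1r (gtr0_norm bk) mulrC ler_pM2r//.
by apply: le_trans E1 _; rewrite lerDl.
Qed.

End ReciprocityAsymptotics.

Section WiltonConvergence.
Context {R : realType}.
Implicit Types x : R.

(** For fixed [k], the partial sums at [x] are those at [alpha_k], scaled by
    [beta_(k-1)] with a sign, up to a sequence that converges as [N] grows. *)
Lemma phi1_sum_descent x (k : nat) : unit_irrational x -> exists l : R,
  forall (e : R) (B : nat), 0 < e -> exists N0 : nat, forall N : nat, (N0 <= N)%N ->
  exists2 N' : nat, (B <= N')%N &
  `|phi1_sum x N - l - (-1) ^+ k * beta_pred k x * phi1_sum (alpha k x) N'| <= e.
Proof.
move=> ux; elim: k => [|k [l ih]].
  exists 0 => e B e0; exists B => N BN; exists N => //.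
  by rewrite expr0 beta_pred0 !mul1r subr0 subrr normr0 ltW.
have uk := alpha_unit k ux; have /andP[a0 a1] := alpha_itv k ux.
have bk := beta_pred_gt0 k ux; have b1 := beta_pred_le1 k ux.
have [C C0 hC] := @reciprocity_asymptotics R; have [L _ hL] := hC _ uk.
exists (l + (-1) ^+ k * beta_pred k x * L) => e B e0.
pose B1 := (B + (Num.truncn (2 * C / e)).+1)%N.
pose B' := (Num.truncn (B1%:R / alpha k x)).+1.
have e20 : 0 < e / 2 by rewrite divr_gt0.
have [N0 hN0] := ih (e / 2) B' e20; exists N0 => N NN.
have [N' BN' hN'] := hN0 N NN.
have BM : (B1 <= Num.truncn (N'%:R * alpha k x))%N.
  rewrite truncn_ge_nat; last by rewrite mulr_ge0// ltW.
  rewrite -ler_pdivrMr//; apply: ltW.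
  by apply: lt_le_trans (truncnS_gt _) _; rewrite ler_nat.
exists (Num.truncn (N'%:R * alpha k x)).
  by apply: leq_trans BM; rewrite leq_addr.
set M := Num.truncn _ in BM *.
have M0 : (0 < M)%N by apply: leq_trans BM; rewrite /B1 addnS.
have hE := hL N' M0; rewrite -/M in hE.
have CM : C / M%:R <= e / 2.
  have MR : 0 < M%:R :> R by rewrite ltr0n.
  have h : 2 * C / e <= M%:R.
    apply: le_trans (ltW (truncnS_gt _)) _; rewrite ler_nat.
    by apply: leq_trans BM; rewrite leq_addl.
  by move: h; rewrite !ler_pdivrMr//; clear; lra.
have -> : phi1_sum x N - (l + (-1) ^+ k * beta_pred k x * L) -
    (-1) ^+ k.+1 * beta_pred k.+1 x * phi1_sum (alpha k.+1 x) M =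
  (phi1_sum x N - l - (-1) ^+ k * beta_pred k x * phi1_sum (alpha k x) N') +
  (-1) ^+ k * beta_pred k x * (reciprocity_sum (alpha k x) N' - L).
  by rewrite (phi1_sum_gauss N' uk) -/M -alphaS beta_predS exprS; ring.
apply: le_trans (ler_normD _ _) _.
rewrite [leRHS](_ : e = e / 2 + e / 2); last by clear; lra.
rewrite lerD// !normrM normrX normrN1 expr1n mul1r (gtr0_norm bk).
by apply: le_trans (le_trans hE CM); rewrite ler_piMl.
Qed.

Lemma wilton_term_cvg0 x : cvgn (series (wilton_term x)) ->
  gamma_ ^~ x @ \oo --> (0 : R).
Proof.
move=> /cvg_series_cvg_0 /cvgrPdist_le h; apply/cvgrPdist_le => e /h.
apply: filterS => k; rewrite !sub0r !normrN /wilton_term.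
by rewrite normrM normrX normrN1 expr1n mul1r.
Qed.

(** By the descent, the oscillation of the partial sums at [x] is at most that of
    [beta_(k-1)] times the partial sums at [alpha_k], which the tail of the Wilton
    series controls uniformly in the number of terms. *)
Lemma phi1_sum_cvg_wilton x : wilton_number x -> cvgn (phi1_sum x).
Proof.
case=> x01 irr cw; have ux : unit_irrational x by split.
have [C C0 hC] := @phi1_sum_wilton_block R.
apply/cauchy_cvgP/cauchy_exP => _/posnumP[e].
set e' := e%:num / 8; have e'0 : 0 < e' by rewrite divr_gt0.
have /cvgrPdist_le/(_ _ e'0)[k1 _ hk1] := cw.
have /cvgrPdist_le/(_ _ e'0)[k2 _ hk2] := wilton_term_cvg0 cw.
have CC : 0 < 3 * C + 1 by move: C0; clear; lra.
have [k3 hk3] := beta_pred_small ux (divr_gt0 e'0 CC).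
pose k := maxn k1 (maxn k2 k3).
have [l hl] := phi1_sum_descent k ux; have [N0 hN0] := hl e' 0 e'0.
exists l; exists N0 => // N /= NN; rewrite /ball /= distrC.
have [N' _ hN'] := hN0 N NN.
have [K kK hK] := hC x ux N' k.
have hw n : (k <= n)%N -> `|wilton_term x n| <= e'.
  move=> kn; have := hk2 n (leq_trans _ kn); rewrite sub0r normrN => h.
  by rewrite /wilton_term normrM normrX normrN1 expr1n mul1r h// leq_max leq_maxl orbT.
have hs : `|\sum_(k <= j < K) wilton_term x j| <= e' + e'.
  have -> : \sum_(k <= j < K) wilton_term x j =
      (limn (series (wilton_term x)) - series (wilton_term x) k) -
      (limn (series (wilton_term x)) - series (wilton_term x) K).
    by rewrite /series/= [in RHS](big_cat_nat (leq0n k) kK)/=; ring.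
  apply: le_trans (ler_normB _ _) _.
  by rewrite lerD ?hk1//= ?leq_maxl// (leq_trans _ kK)// leq_maxl.
have hb : C * \sum_(k <= j < K.+1) beta_pred j x <= e'.
  apply: le_trans (ler_wpM2l C0 (sum_beta_pred k K.+1 ux)) _.
  have hbk : beta_pred k x <= e' / (3 * C + 1).
    apply: le_trans hk3; apply: beta_pred_homo => //.
    by rewrite leq_max leq_maxr orbT.
  move: hbk; rewrite ler_pdivlMr//; have := beta_pred_gt0 k ux.
  by move: (beta_pred k x) => b; clear; nra.
have {}hK := le_trans hK (lerD hb (hw K kK)).
have h1 : `|(-1) ^+ k * beta_pred k x * phi1_sum (alpha k x) N'| <= e' + e' + e'.
  rewrite -[_ * _](addrK ((\sum_(k <= j < K) wilton_term x j) / 2)).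
  apply: le_trans (ler_normB _ _) _; rewrite lerD// normrM.
  by rewrite [`|2^-1|]ger0_norm ?invr_ge0//; move: hs; move: (`|\sum_(k <= j < K) _ j|) => u; clear; lra.
rewrite -[_ - _](subrK ((-1) ^+ k * beta_pred k x * phi1_sum (alpha k x) N')).
apply: le_lt_trans (ler_normD _ _) _; apply: le_lt_trans (lerD hN' h1) _.
by rewrite (_ : e%:num = 8 * e'); [move: e'0; clear; lra|rewrite /e'; field].
Qed.

End WiltonConvergence.

(** * Integrals of bounded functions over segments *)

Section SegmentIntegral.
Context {R : realType}.
Notation mu := (@lebesgue_measure R).
Implicit Types (f g : R -> R) (a b c : R).

(** A class closed under the algebra of partial sums and integrable on every
    segment. *)
Definition bounded_measurable f := measurable_fun setT f /\ exists M, forall x, `|f x| <= M.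

Lemma bounded_measurable_cst (r : R) : bounded_measurable (cst r).
Proof. by split=> //; exists `|r|. Qed.

Lemma bounded_measurableD f g : bounded_measurable f -> bounded_measurable g ->
  bounded_measurable (fun x => f x + g x).
Proof.
move=> [mf [M hM]] [mg [N hN]]; split; first exact: measurable_funD.
by exists (M + N) => x; rewrite (le_trans (ler_normD _ _))// lerD.
Qed.

Lemma bounded_measurableM f g : bounded_measurable f -> bounded_measurable g ->
  bounded_measurable (fun x => f x * g x).
Proof.
move=> [mf [M hM]] [mg [N hN]]; split; first exact: measurable_funM.
by exists (M * N) => x; rewrite normrM ler_pM.
Qed.

Lemma bounded_measurableZ (r : R) f : bounded_measurable f ->
  bounded_measurable (fun x => r * f x).
Proof. by move=> bf; exact: (bounded_measurableM (bounded_measurable_cst r) bf). Qed.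

Lemma bounded_measurableB f g : bounded_measurable f -> bounded_measurable g ->
  bounded_measurable (fun x => f x - g x).
Proof.
move=> bf bg; have := bounded_measurableD bf (bounded_measurableZ (-1) bg).
by under eq_fun do rewrite mulN1r.
Qed.

Lemma bounded_measurable_norm f : bounded_measurable f ->
  bounded_measurable (fun x => `|f x|).
Proof.
move=> [mf [M hM]]; split; first exact: measurableT_comp.
by exists M => x; rewrite normr_id.
Qed.

Lemma bounded_measurable_sum (I : eqType) (s : seq I) (h : I -> R -> R) :
  (forall i, i \in s -> bounded_measurable (h i)) ->
  bounded_measurable (fun x => \sum_(i <- s) h i x).
Proof.
elim: s => [|i s ih] bh.
  by under eq_fun do rewrite big_nil; exact: bounded_measurable_cst.
under eq_fun do rewrite big_cons; apply: bounded_measurableD.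
  by apply: bh; rewrite mem_head.
by apply: ih => j js; apply: bh; rewrite in_cons js orbT.
Qed.

Lemma bounded_measurable_integrable f a b : bounded_measurable f ->
  mu.-integrable `[a, b] (EFin \o f).
Proof.
move=> [mf [M hM]]; apply: measurable_bounded_integrable => //.
- exact: compact_finite_measure (@segment_compact _ _ _).
- exact: measurable_funS mf.
- exists M; split; first exact: num_real.
  by move=> N MN x _ /=; apply: le_trans (hM x) _; exact: ltW.
Qed.

Lemma segment_integrableB f g a b : mu.-integrable `[a, b] (EFin \o f) ->
  mu.-integrable `[a, b] (EFin \o g) ->
  mu.-integrable `[a, b] (EFin \o (fun x => f x - g x)).
Proof. by move=> fi gi; exact: (@integrableB _ _ R mu _ (measurable_itv _) _ _ fi gi). Qed.

Lemma segment_integrableD f g a b : mu.-integrable `[a, b] (EFin \o f) ->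
  mu.-integrable `[a, b] (EFin \o g) ->
  mu.-integrable `[a, b] (EFin \o (fun x => f x + g x)).
Proof. by move=> fi gi; exact: (@integrableD _ _ R mu _ (measurable_itv _) _ _ fi gi). Qed.

Lemma segment_integrable_norm f a b : mu.-integrable `[a, b] (EFin \o f) ->
  mu.-integrable `[a, b] (EFin \o (fun x => `|f x|)).
Proof. by move=> fi; exact: (@integrable_norm _ _ R mu _ _ fi). Qed.

Lemma Rintegral_chasles f a b c : mu.-integrable `[a, c] (EFin \o f) -> a <= b <= c ->
  \int[mu]_(x in `[a, c]) f x = \int[mu]_(x in `[a, b]) f x + \int[mu]_(x in `[b, c]) f x.
Proof.
move=> fi /andP[ab bc].
have := @Rintegral_itvB _ f (BLeft a) (BRight c) b fi.
rewrite !bnd_simp => /(_ ab bc) e; rewrite -(@Rintegral_itv_obnd_cbnd _ b (BRight c)).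
  by rewrite -e addrC subrK.
by apply: integrableS fi => //; apply: subset_itvr; rewrite bnd_simp.
Qed.

Lemma eq_Rintegral_oo f g a b : measurable_fun setT f -> measurable_fun setT g ->
  (forall x, a < x < b -> f x = g x) ->
  \int[mu]_(x in `[a, b]) f x = \int[mu]_(x in `[a, b]) g x.
Proof.
move=> mf mg fg; have mE (h : R -> R) : measurable_fun setT h -> measurable_fun `]a, b[ (EFin \o h).
  by move=> mh; apply/measurable_EFinP; exact: measurable_funS mh.
rewrite /Rintegral (integral_itv_bndoo _ _ (mE _ mf)) (integral_itv_bndoo _ _ (mE _ mg)).
congr fine; apply: eq_integral => x; rewrite inE /= in_itv /= => xab.
by rewrite fg.
Qed.

Lemma Rintegral_segment_cst a b (r : R) : a <= b ->
  \int[mu]_(x in `[a, b]) r = r * (b - a).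
Proof.
move=> ab; rewrite Rintegral_cst//= lebesgue_measure_itv /= lte_fin.
by move: ab; rewrite le_eqVlt => /predU1P[->|->//]; rewrite ltxx subrr.
Qed.

Lemma Rintegral_le_bound f a b (C : R) : mu.-integrable `[a, b] (EFin \o f) -> a <= b ->
  (forall x, a <= x <= b -> f x <= C) -> \int[mu]_(x in `[a, b]) f x <= C * (b - a).
Proof.
move=> fi ab fC; rewrite -(Rintegral_segment_cst C ab); apply: le_Rintegral => //.
by apply: bounded_measurable_integrable (bounded_measurable_cst C).
Qed.

Lemma is_derive_continuous f g : (forall x, is_derive x (1 : R) f (g x)) -> continuous f.
Proof.
move=> df x; apply: differentiable_continuous; apply/derivable1_diffP.
exact: (@ex_derive _ _ _ _ _ _ _ (df x)).
Qed.

(** [f] is only compared with the derivative on the open segment, so that functions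
    with jumps can be integrated piece by piece. *)
Lemma Rintegral_primitive f g G a b : measurable_fun setT f -> a <= b ->
  (forall x, is_derive x (1 : R) G (g x)) -> continuous g ->
  (forall x, a < x < b -> f x = g x) -> \int[mu]_(x in `[a, b]) f x = G b - G a.
Proof.
move=> mf ab dG cg fg.
have mg : measurable_fun setT g by exact: continuous_measurable_fun.
rewrite (eq_Rintegral_oo mf mg fg); move: ab; rewrite le_eqVlt => /orP[/eqP ->|ab].
  by rewrite set_itv1 Rintegral_set1 subrr.
have cG := is_derive_continuous dG.
rewrite /Rintegral (@continuous_FTC2 _ g G)//.
- exact: continuous_subspaceT.
- split; first by move=> x _; exact: (@ex_derive _ _ _ _ _ _ _ (dG x)).
  + by apply: cvg_at_right_filter; exact: cG.
  + by apply: cvg_at_left_filter; exact: cG.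
- by move=> x _; rewrite derive1E; exact: derive_val.
Qed.

End SegmentIntegral.

(** * Correlations of dilated sawtooth functions *)

Section Correlation.
Context {R : realType}.
Notation mu := (@lebesgue_measure R).

(** An expression by monotone functions, hence measurable. *)
Lemma B1_floor_ceil (t : R) : B1 t = t - ((Num.floor t)%:~R + (Num.ceil t)%:~R) / 2.
Proof.
have fc (z : int) (u : R) : 0 < u < 1 -> Num.floor (z%:~R + u) = z.
  by move=> u01; apply: floor_def; rewrite intrD; lra.
have [[z ->]|[z [u [u01 ->]]]] := sawtooth_cases t.
  by rewrite B1_int intrKceil intrKfloor; field.
rewrite B1_eq// fc// ceilNfloor.
have -> : - (z%:~R + u) = (- z - 1)%:~R + (1 - u) :> R by rewrite intrB mulrNz; ring.
rewrite fc; last lra.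
by rewrite mulrNz intrB mulrNz; field.
Qed.

Lemma measurable_B1 : measurable_fun setT (@B1 R).
Proof.
rewrite (_ : B1 = fun t => t - 2^-1 * ((Num.floor t)%:~R + (Num.ceil t)%:~R)); last first.
  by apply/funext => t; rewrite B1_floor_ceil mulrC.
apply: measurable_funB => //; apply: measurable_funM => //.
apply: measurable_funD; apply: nondecreasing_measurable => // x y xy.
- by rewrite ler_int le_floor.
- by rewrite ler_int le_ceil.
Qed.

Lemma bounded_measurable_B1 (n : nat) : bounded_measurable (fun t : R => B1 (n%:R * t)).
Proof.
split; last by exists 2^-1 => x; exact: B1_bound.
by apply: (measurableT_comp measurable_B1); exact: measurable_funM.
Qed.

Definition B3 (t : R) : R :=
  frac_part t ^+ 3 - 3 / 2 * frac_part t ^+ 2 + frac_part t / 2.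

Lemma B3Dz (t : R) (z : int) : B3 (t + z%:~R) = B3 t.
Proof. by rewrite /B3 frac_partDz. Qed.

Lemma B3_eq (u : R) (z : int) : 0 <= u <= 1 ->
  B3 (z%:~R + u) = u ^+ 3 - 3 / 2 * u ^+ 2 + u / 2.
Proof.
move=> /andP[u0]; rewrite le_eqVlt => /orP[/eqP ->|u1]; last first.
  by rewrite /B3 frac_part_eq// u0.
have -> : z%:~R + 1 = (z + 1)%:~R + 0 :> R by rewrite intrD; ring.
by rewrite /B3 frac_part_eq; lra.
Qed.

(** A primitive of [(u t + v) B1(n t)], by parts from [B2' = 2 B1] and
    [B3' = 3 B2]; it is continuous across the jumps of [B1]. *)
Definition sawtooth_primitive (n : nat) (u v t : R) : R :=
  (u * t + v) * B2 (n%:R * t) / (2 * n%:R) - u * B3 (n%:R * t) / (6 * n%:R ^+ 2).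

(** Induction on the number of jumps between [a] and [b]. *)
Lemma Rintegral_sawtooth (n : nat) (u v a b : R) : (0 < n)%N -> a <= b ->
  \int[mu]_(t in `[a, b]) ((u * t + v) * B1 (n%:R * t)) =
  sawtooth_primitive n u v b - sawtooth_primitive n u v a.
Proof.
move=> n0; have N0 : 0 < n%:R :> R by rewrite ltr0n.
pose f (t : R) := (u * t + v) * B1 (n%:R * t).
have mlin : measurable_fun setT (fun t : R => u * t + v).
  by apply: measurable_funD => //; exact: measurable_funM.
have mf : measurable_fun setT f.
  by apply: measurable_funM => //; have [] := bounded_measurable_B1 n.
have fi (x y : R) : mu.-integrable `[x, y] (EFin \o f).
  apply: measurable_bounded_integrable => //.
  - exact: compact_finite_measure (@segment_compact _ _ _).
  - exact: measurable_funS mf.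
  - exists ((`|u| * Num.max `|x| `|y| + `|v|) * 2^-1); split; first exact: num_real.
    move=> M hM t /=; rewrite in_itv /= => /andP[xt ty].
    apply: le_trans (ltW hM); rewrite normrM; apply: ler_pM => //; last exact: B1_bound.
    apply: le_trans (ler_normD _ _) _; rewrite lerD2r normrM ler_wpM2l//.
    rewrite ler_norml; apply/andP; split.
      rewrite lerNl; apply: le_trans (_ : - x <= _); first by rewrite lerN2.
      by apply: le_trans (ler_norm _) _; rewrite normrN le_max lexx.
    by apply: le_trans ty _; apply: le_trans (ler_norm _) _; rewrite le_max lexx orbT.
have piece (k : int) (x y : R) : x <= y -> k%:~R <= n%:R * x -> n%:R * y <= k%:~R + 1 ->
    \int[mu]_(t in `[x, y]) f t = sawtooth_primitive n u v y - sawtooth_primitive n u v x.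
  move=> xy kx yk.
  pose w (t : R) := n%:R * t - k%:~R.
  pose g (t : R) := (u * t + v) * (w t - 2^-1).
  pose G (t : R) := (2 * n%:R)^-1 * ((u * t + v) * (w t * w t - w t + 6^-1)) -
    u / (6 * n%:R ^+ 2) * (w t * w t * w t - 3 / 2 * (w t * w t) + 2^-1 * w t).
  have eG (t : R) : x <= t <= y -> sawtooth_primitive n u v t = G t.
    move=> /andP[xt ty].
    have nxt : n%:R * x <= n%:R * t by rewrite ler_pM2l.
    have nty : n%:R * t <= n%:R * y by rewrite ler_pM2l.
    rewrite /sawtooth_primitive.
    have e : n%:R * t = k%:~R + w t by rewrite /w; ring.
    have w01 : 0 <= w t <= 1 by rewrite /w; lra.
    rewrite e B2_eq// B3_eq// /G; field; lra.
  rewrite !eG ?lexx ?xy//; apply: (Rintegral_primitive mf xy (g := g)).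
  - move=> t; rewrite /G /g /w; apply: is_derive_eq.
    rewrite !scaler0 !addr0 !scaler1 /GRing.scale /=; field; lra.
  - apply: (@is_derive_continuous _ g (fun t => u * (w t - 2^-1) + (u * t + v) * n%:R)).
    move=> t; rewrite /g /w; apply: is_derive_eq.
    by rewrite !scaler0 !addr0 !scaler1 /GRing.scale /=; ring.
  - move=> t /andP[xt ty]; rewrite /f /g; congr (_ * _).
    have nxt : n%:R * x < n%:R * t by rewrite ltr_pM2l.
    have nty : n%:R * t < n%:R * y by rewrite ltr_pM2l.
    have {1}-> : n%:R * t = k%:~R + w t by rewrite /w; ring.
    by rewrite B1_eq// /w; lra.
move=> ab; pose m := absz (Num.floor (n%:R * b) - Num.floor (n%:R * a)).
have : Num.floor (n%:R * b) - Num.floor (n%:R * a) = m%:Z.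
  by rewrite gez0_abs// subr_ge0 le_floor// ler_pM2l.
move: m => m; elim: m a ab => [|m ih] a ab hm.
  apply: (piece (Num.floor (n%:R * a))) => //; first exact: floor_le.
  have -> : Num.floor (n%:R * a) = Num.floor (n%:R * b).
    by move: hm; move: (Num.floor _) (Num.floor _) => y z; lia.
  by have := floorD1_gt (n%:R * b); rewrite intrD; lra.
pose k := Num.floor (n%:R * a); pose c : R := (k + 1)%:~R / n%:R.
have nc : n%:R * c = (k + 1)%:~R by rewrite /c mulrC divfK// gt_eqF.
have ac : a <= c.
  by rewrite -(ler_pM2l N0) nc ltW// floorD1_gt.
have cb : c <= b.
  rewrite -(ler_pM2l N0) nc; apply: le_trans (floor_le _); rewrite ler_int.
  by move: hm; rewrite /k; move: (Num.floor _) (Num.floor _) => y z; lia.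
rewrite (@Rintegral_chasles _ f a c b (fi a b)) ?ac//.
rewrite (piece k a c)//; first last.
- by rewrite nc intrD.
- exact: floor_le.
rewrite ih// ?nc ?intrKfloor; last first.
  by move: hm; rewrite /k; move: (Num.floor _) (Num.floor _) => y z; lia.
by ring.
Qed.

(** With [a = m / gcd(m, n)], the points [j n / m] run [gcd(m, n)] times over the
    multiples of [1 / a] modulo 1. *)
Lemma sum_B2_residues (m n : nat) : (0 < m)%N ->
  \sum_(j < m) B2 (n%:R * j%:R / m%:R) = (gcdn m n)%:R ^+ 2 / (6 * m%:R) :> R.
Proof.
move=> m0; set g := gcdn m n; have g0 : (0 < g)%N by rewrite gcdn_gt0 m0.
have [a ma] := dvdnP (dvdn_gcdl m n); have [b nb] := dvdnP (dvdn_gcdr m n).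
rewrite -/g in ma nb.
have a0 : (0 < a)%N by move: m0; rewrite ma muln_gt0 => /andP[].
have A0 : 0 < a%:R :> R by rewrite ltr0n.
have G0 : 0 < g%:R :> R by rewrite ltr0n.
have cab : coprimez a b.
  rewrite /coprimez /gcdz /= eqz_nat -(eqn_pmul2r g0) muln_gcdl mul1n.
  by rewrite -ma -nb.
have e j : n%:R * j%:R / m%:R = b%:R * j%:R / a%:R :> R.
  by rewrite ma nb !natrM; field; rewrite !gt_eqF.
under eq_bigr do rewrite e.
have one_period (z : nat) : \sum_(r < a) B2 (b%:R * (z * a + r)%:R / a%:R) = (6 * a%:R)^-1 :> R.
  have step (r : 'I_a) : B2 (b%:R * (z * a + r)%:R / a%:R) =
      B2 ((absz ((0 + r%:Z * b%:Z) %% a%:Z)%Z)%:R / a%:R) :> R.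
    set s := absz _.
    have [d ds] : exists d : int, r%:Z * b%:Z = d * a%:Z + s%:Z.
      exists ((r%:Z * b%:Z) %/ a%:Z)%Z.
      by rewrite {1}(divz_eq (r%:Z * b%:Z) a%:Z) /s add0r gez0_abs// modz_ge0//; lia.
    have ds2 : r%:R * b%:R = d%:~R * a%:R + s%:R :> R.
      by have := congr1 (fun k : int => k%:~R : R) ds; rewrite intrD !intrM -!pmulrn.
    rewrite -(B2Dz (s%:R / a%:R) (b%:Z * z%:Z + d)); congr B2.
    rewrite intrD intrM natrD natrM -!pmulrn.
    have -> : b%:R * (z%:R * a%:R + r%:R) / a%:R = b%:R * z%:R + (r%:R * b%:R) / a%:R :> R.
      by field; rewrite gt_eqF//.
    by rewrite ds2; field; rewrite gt_eqF//.
  under eq_bigr do rewrite step.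
  rewrite (sum_residues 0 (fun s => B2 (s%:R / a%:R))) //.
  have hsum k : (k <= a)%N -> \sum_(s < k) B2 (s%:R / a%:R) =
      k%:R * ((k%:R - 1) * (2 * k%:R - 1) / (6 * a%:R ^+ 2) - (k%:R - 1) / (2 * a%:R) + 6^-1) :> R.
    elim: k => [|k ih] ka; first by rewrite big_ord0 mul0r.
    rewrite big_ord_recr /= ih 1?ltnW// -natr1.
    have -> : B2 (k%:R / a%:R) = (k%:R / a%:R) ^+ 2 - k%:R / a%:R + 6^-1 :> R.
      rewrite -[k%:R / a%:R in LHS]add0r (B2_eq 0)// divr_ge0//= ler_pdivrMr// mul1r ler_nat.
      exact: ltnW.
    by field; rewrite gt_eqF//.
  by rewrite hsum//; field; rewrite gt_eqF//.
have whole (k : nat) : \sum_(j < k * a) B2 (b%:R * j%:R / a%:R) = k%:R / (6 * a%:R) :> R.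
  elim: k => [|k ih]; first by rewrite mul0n big_ord0 mul0r.
  rewrite mulSnr big_split_ord /= ih one_period -natr1; field; rewrite gt_eqF//.
by rewrite ma mulnC whole natrM; field; rewrite !gt_eqF.
Qed.

(** [B1(m t)] is linear between consecutive multiples of [1 / m]; integrating by
    parts there and summing, the [B3] terms telescope to 0 over a period and the
    [B2] terms form the sum of the previous lemma. *)
Lemma Rintegral_B1_correlation (m n : nat) (c : int) : (0 < m)%N -> (0 < n)%N ->
  \int[mu]_(t in `[c%:~R, c%:~R + 1]) (B1 (m%:R * t) * B1 (n%:R * t)) =
  (gcdn m n)%:R ^+ 2 / (12 * m%:R * n%:R) :> R.
Proof.
move=> m0 n0; have M0 : 0 < m%:R :> R by rewrite ltr0n.
have N0 : 0 < n%:R :> R by rewrite ltr0n.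
pose p (j : nat) : R := c%:~R + j%:R / m%:R.
pose f (t : R) := B1 (m%:R * t) * B1 (n%:R * t).
have bf : bounded_measurable f by exact: bounded_measurableM (bounded_measurable_B1 m) (bounded_measurable_B1 n).
have p0 : p 0 = c%:~R by rewrite /p mul0r addr0.
have pS j : p j <= p j.+1 by rewrite /p lerD2l ler_pM2r ?invr_gt0// ler_nat.
have p0j j : p 0 <= p j by rewrite /p lerD2l ler_pM2r ?invr_gt0// ler_nat.
have piece j : \int[mu]_(t in `[p j, p j.+1]) f t =
    (B2 (n%:R * p j.+1) + B2 (n%:R * p j)) / (4 * n%:R) -
    m%:R * (B3 (n%:R * p j.+1) - B3 (n%:R * p j)) / (6 * n%:R ^+ 2).
  pose v := - (m%:R * p j + 2^-1).
  have mp : m%:R * p j.+1 = m%:R * p j + 1 by rewrite /p -natr1; field; lra.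
  rewrite (@eq_Rintegral_oo _ f (fun t => (m%:R * t + v) * B1 (n%:R * t))).
  - rewrite Rintegral_sawtooth// /sawtooth_primitive.
    have -> : m%:R * p j.+1 + v = 2^-1 by rewrite /v mp; lra.
    have -> : m%:R * p j + v = - 2^-1 by rewrite /v; lra.
    by field; lra.
  - by case: bf.
  - apply: measurable_funM; last by have [] := bounded_measurable_B1 n.
    by apply: measurable_funD => //; exact: measurable_funM.
  - move=> t /andP[jt tj]; rewrite /f; congr (_ * _).
    have h1 : m%:R * p j < m%:R * t by rewrite ltr_pM2l.
    have h2 : m%:R * t < m%:R * p j.+1 by rewrite ltr_pM2l.
    have mpj : m%:R * p j = (m%:Z * c + j%:Z)%:~R.
      by rewrite intrD intrM /p -!pmulrn; field; lra.
    have -> : m%:R * t = (m%:Z * c + j%:Z)%:~R + (m%:R * t - m%:R * p j) by rewrite mpj; ring.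
    by rewrite B1_eq -?mpj /v; lra.
have sum_pieces k : \int[mu]_(t in `[p 0, p k]) f t =
    \sum_(j < k) B2 (n%:R * p j) / (2 * n%:R) +
    (B2 (n%:R * p k) - B2 (n%:R * p 0)) / (4 * n%:R) -
    m%:R * (B3 (n%:R * p k) - B3 (n%:R * p 0)) / (6 * n%:R ^+ 2).
  elim: k => [|k ih].
    by rewrite set_itv1 Rintegral_set1 big_ord0; field; lra.
  rewrite (@Rintegral_chasles _ f (p 0) (p k) (p k.+1)) ?p0j ?pS//; last first.
    exact: bounded_measurable_integrable.
  by rewrite ih piece big_ord_recr /=; field; lra.
have pm : p m = c%:~R + 1 by rewrite /p divff// gt_eqF.
rewrite -pm -p0 sum_pieces.
have npm : n%:R * p m = n%:R * p 0 + n%:Z%:~R by rewrite pm p0 -pmulrn; ring.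
rewrite npm B2Dz B3Dz !subrr mulr0 !mul0r addr0 subr0 -mulr_suml.
have -> : \sum_(j < m) B2 (n%:R * p j) = \sum_(j < m) B2 (n%:R * j%:R / m%:R).
  apply: eq_bigr => j _; rewrite -(B2Dz (n%:R * j%:R / m%:R) (n%:Z * c)); congr B2.
  by rewrite intrM /p -pmulrn; ring.
by rewrite sum_B2_residues//; field; lra.
Qed.

End Correlation.

Section L2Tail.
Context {R : realType}.
Notation mu := (@lebesgue_measure R).

Lemma Rintegral_bounded_sum (I : eqType) (s : seq I) (h : I -> R -> R) (a b : R) :
  (forall i, i \in s -> bounded_measurable (h i)) ->
  \int[mu]_(x in `[a, b]) (\sum_(i <- s) h i x) = \sum_(i <- s) \int[mu]_(x in `[a, b]) h i x.
Proof.
elim: s => [|i s ih] bh.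
  by under eq_Rintegral do rewrite big_nil; rewrite Rintegral_cst// mul0r big_nil.
have bi : bounded_measurable (h i) by apply: bh; rewrite mem_head.
have bs j : j \in s -> bounded_measurable (h j).
  by move=> js; apply: bh; rewrite in_cons js orbT.
under eq_Rintegral do rewrite big_cons.
rewrite RintegralD//; first by rewrite ih// big_cons.
- exact: bounded_measurable_integrable.
- exact: bounded_measurable_integrable (bounded_measurable_sum bs).
Qed.

Lemma sum_inv_sqr_le (K L : nat) :
  \sum_(K.+1 <= k < L.+1) (k%:R ^+ 2)^-1 <= 2 / K.+1%:R :> R.
Proof.
have main (n : nat) : \sum_(K.+1 <= k < (K.+1 + n)%N.+1) (k%:R ^+ 2)^-1 <=
    2 / K.+1%:R - (K.+1 + n)%:R^-1 :> R.
  elim: n => [|n ih].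
    rewrite addn0 big_nat1; have k1 : 1 <= K.+1%:R :> R by rewrite ler1n.
    have : (K.+1%:R ^+ 2)^-1 <= K.+1%:R^-1 :> R.
      by rewrite lef_pV2 ?posrE ?exprn_gt0 ?ltr0n// ler_eXnr.
    by move: (_^-1) (_^-1); clear => a b; lra.
  rewrite addnS big_nat_recr/=; last by rewrite (leq_trans (leq_addr n _)).
  have := @invr_sqr_le R (K.+1 + n) isT; move: ih.
  by move: (bigop _ _ _) ((_ ^+ 2)^-1) ((K.+1 + n)%:R^-1) ((K.+1 + n).+1%:R^-1) (2 / _); clear => a b c d e; lra.
have [LK|KL] := leqP L.+1 K.+1; first by rewrite big_geq// divr_ge0.
have := main (L - K.+1)%N; rewrite subnKC//; move/le_trans; apply.
by rewrite gerDl oppr_le0 invr_ge0.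
Qed.

Lemma sum_dvdn_inv_sqr (d N M : nat) : (0 < d)%N ->
  \sum_(N.+1 <= m < M.+1) (d %| m)%N%:R / m%:R ^+ 2 =
  (\sum_((N %/ d).+1 <= k < (M %/ d).+1) (k%:R ^+ 2)^-1) / d%:R ^+ 2 :> R.
Proof.
move=> d0; have [MN|NM] := leqP M N.
  by rewrite !big_geq ?mul0r// ltnS leq_div2r.
have -> : M = (N + (M - N))%N by rewrite subnKC// ltnW.
elim: (M - N)%N => [|n ih]; first by rewrite addn0 !big_geq// mul0r.
rewrite addnS big_nat_recr/=; last by rewrite ltnS leq_addr.
rewrite ih divnS//; case: (boolP (d %| (N + n).+1)%N) => [/dvdnP[m hm]|_]; last first.
  by rewrite mul0r addr0 add0n.
have m0 : (0 < m)%N by case: m hm.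
have e : ((N + n) %/ d)%N = m.-1.
  by have := divnS (N + n) d0; rewrite hm mulnK// dvdn_mull//= => ->; rewrite add1n.
have NdM : (N %/ d <= (N + n) %/ d)%N by rewrite leq_div2r// leq_addr.
rewrite add1n [in RHS]big_nat_recr//= mulrDl; congr (_ + _).
by rewrite e prednK// hm natrM exprMn invfM mul1r.
Qed.

Lemma sum_dvdn_inv_sqr_le (d N M : nat) : (0 < d)%N ->
  \sum_(N.+1 <= m < M.+1) (d %| m)%N%:R / m%:R ^+ 2 <= 2 / (d%:R * (maxn N d)%:R) :> R.
Proof.
move=> d0; have D0 : 0 < d%:R :> R by rewrite ltr0n.
have M0 : 0 < (maxn N d)%:R :> R by rewrite ltr0n leq_max d0 orbT.
rewrite sum_dvdn_inv_sqr// ler_pdivrMr ?exprn_gt0//.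
apply: le_trans (sum_inv_sqr_le _ _) _.
rewrite (_ : 2 / (d%:R * (maxn N d)%:R) * d%:R ^+ 2 = 2 * (d%:R / (maxn N d)%:R)); last first.
  by field; rewrite !gt_eqF.
rewrite ler_pM2l// ler_pdivlMr// mulrC ler_pdivrMr ?ltr0n//.
rewrite -natrM ler_nat geq_max; apply/andP; split; last by rewrite leq_pmulr.
by rewrite mulnC ltnW// ltn_ceil.
Qed.

Lemma sum_inv_max_sqr (N M : nat) : (0 < N)%N ->
  \sum_(1 <= d < M.+1) ((maxn N d)%:R ^+ 2)^-1 <= 3 / N%:R :> R.
Proof.
move=> N0; have NR : 0 < N%:R :> R by rewrite ltr0n.
have first_part L : (L <= N)%N -> \sum_(1 <= d < L.+1) ((maxn N d)%:R ^+ 2)^-1 <= N%:R^-1 :> R.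
  move=> LN; apply: (@le_trans _ _ (\sum_(1 <= d < L.+1) (N%:R ^+ 2)^-1)).
    by apply: ler_sum_nat => d /andP[_ dL]; rewrite (maxn_idPl _)// -ltnS (leq_trans dL).
  rewrite sumr_const_nat subn1 -[_ *+ _.-1]mulr_natl /= ler_pdivrMr ?exprn_gt0//.
  by rewrite expr2 mulrA mulVf ?gt_eqF// mul1r ler_nat.
have [MN|NM] := leqP M N.
  apply: le_trans (first_part M MN) _; rewrite -[leLHS]mul1r ler_pM2r ?invr_gt0//.
  by clear; lra.
rewrite (big_cat_nat (n := N.+1))//= ?ltnS ?(ltnW NM)//.
have -> : \sum_(N.+1 <= d < M.+1) ((maxn N d)%:R ^+ 2)^-1 = \sum_(N.+1 <= d < M.+1) (d%:R ^+ 2)^-1 :> R.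
  by apply: eq_big_nat => d /andP[Nd _]; rewrite (maxn_idPr _)// ltnW.
have h1 := first_part N (leqnn N); have h2 := sum_inv_sqr_le N M.
have h3 : N.+1%:R^-1 <= N%:R^-1 :> R by rewrite lef_pV2 ?posrE ?ltr0n// ler_nat.
move: h1 h2 h3; move: (bigop _ _ _) (bigop _ _ _) (N%:R^-1) (N.+1%:R^-1) => a b c e.
by clear; lra.
Qed.

Lemma gcdn_sqr_le (m n M : nat) : (0 < m <= M)%N ->
  (gcdn m n)%:R ^+ 2 <= \sum_(1 <= d < M.+1) (d %| m)%N%:R * (d %| n)%N%:R * d%:R ^+ 2 :> R.
Proof.
move=> /andP[m0 mM]; set g := gcdn m n.
have gM : (0 < g < M.+1)%N.
  by rewrite gcdn_gt0 m0/= ltnS (leq_trans _ mM)// dvdn_leq// dvdn_gcdl.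
have /andP[g0 gM'] := gM; have gm : (g %| m)%N := dvdn_gcdl m n.
have gn : (g %| n)%N := dvdn_gcdr m n.
rewrite (big_cat_nat (n := g)) ?(ltnW gM')//= [\sum_(g <= i < _) _]big_ltn// gm gn !mul1r addrCA lerDl.
by rewrite addr_ge0// sumr_ge0// => i _; rewrite !mulr_ge0// exprn_ge0.
Qed.

(** Quasi-orthogonality: [gcd(m, n)^2] is dominated by a sum of squares of
    divisors, which separates the double sum over [m] and [n]. *)
Lemma phi1_sum_L2 (N M : nat) (c : int) : (0 < N <= M)%N ->
  \int[mu]_(t in `[c%:~R, c%:~R + 1]) ((phi1_sum t M - phi1_sum t N) ^+ 2) <= N%:R^-1 :> R.
Proof.
move=> /andP[N0 NM]; have NR : 0 < N%:R :> R by rewrite ltr0n.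
pose h (n : nat) (t : R) := n%:R^-1 * B1 (n%:R * t).
have bh n : bounded_measurable (h n).
  by apply: bounded_measurableZ; exact: bounded_measurable_B1.
have -> : (fun t : R => (phi1_sum t M - phi1_sum t N) ^+ 2) =
  (fun t => \sum_(N.+1 <= m < M.+1) \sum_(N.+1 <= n < M.+1) h m t * h n t).
  apply/funext => t; have -> : phi1_sum t M - phi1_sum t N = \sum_(N.+1 <= n < M.+1) h n t.
    rewrite /phi1_sum (big_cat_nat (n := N.+1))//= addrAC subrr add0r.
    by apply: eq_bigr => n _; rewrite mulrC.
  by rewrite expr2 mulr_suml; apply: eq_bigr => m _; rewrite mulr_sumr.
rewrite Rintegral_bounded_sum; last first.
  by move=> m _; apply: bounded_measurable_sum => n _; exact: bounded_measurableM.
have corr m n : (0 < m)%N -> (0 < n)%N ->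
    \int[mu]_(t in `[c%:~R, c%:~R + 1]) (h m t * h n t) =
    12^-1 * ((gcdn m n)%:R ^+ 2 * ((m%:R ^+ 2)^-1 * (n%:R ^+ 2)^-1)) :> R.
  move=> m0 n0; under eq_Rintegral do rewrite /h mulrACA.
  rewrite RintegralZl//; last first.
    apply: bounded_measurable_integrable.
    exact: bounded_measurableM (bounded_measurable_B1 m) (bounded_measurable_B1 n).
  rewrite Rintegral_B1_correlation//.
  have m1 : m%:R != 0 :> R by rewrite pnatr_eq0 -lt0n.
  have n1 : n%:R != 0 :> R by rewrite pnatr_eq0 -lt0n.
  by field; rewrite m1 n1.
pose w (d m : nat) : R := (d %| m)%N%:R / m%:R ^+ 2.
apply: (@le_trans _ _ (12^-1 * \sum_(N.+1 <= m < M.+1) \sum_(N.+1 <= n < M.+1)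
    \sum_(1 <= d < M.+1) d%:R ^+ 2 * (w d m * w d n))).
  rewrite mulr_sumr; apply: ler_sum_nat => m /andP[Nm mM].
  rewrite Rintegral_bounded_sum; last by move=> n _; exact: bounded_measurableM.
  rewrite mulr_sumr; apply: ler_sum_nat => n /andP[Nn nM].
  have m0 : (0 < m)%N by exact: leq_ltn_trans Nm.
  have n0 : (0 < n)%N by exact: leq_ltn_trans Nn.
  rewrite corr// ler_pM2l ?invr_gt0//.
  have mn0 : 0 <= (m%:R ^+ 2)^-1 * (n%:R ^+ 2)^-1 :> R.
    by rewrite mulr_ge0 ?invr_ge0 ?exprn_ge0.
  have m0M : (0 < m <= M)%N by rewrite m0 -ltnS.
  apply: le_trans (ler_wpM2r mn0 (gcdn_sqr_le n m0M)) _.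
  rewrite mulr_suml le_eqVlt; apply/orP; left; apply/eqP.
  by apply: eq_bigr => d _; rewrite /w; ring.
have swap : \sum_(N.+1 <= m < M.+1) \sum_(N.+1 <= n < M.+1)
    \sum_(1 <= d < M.+1) d%:R ^+ 2 * (w d m * w d n) =
  \sum_(1 <= d < M.+1) d%:R ^+ 2 * (\sum_(N.+1 <= m < M.+1) w d m) ^+ 2.
  under eq_bigr do rewrite exchange_big_nat/=.
  rewrite exchange_big_nat/=; apply: eq_bigr => d _.
  rewrite (expr2 (bigop _ _ _)) mulr_suml mulr_sumr; apply: eq_bigr => m _.
  by rewrite mulr_sumr mulr_sumr; apply: eq_bigr => n _.
have bound : \sum_(1 <= d < M.+1) d%:R ^+ 2 * (\sum_(N.+1 <= m < M.+1) w d m) ^+ 2 <=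
    4 * (3 / N%:R).
  apply: (@le_trans _ _ (\sum_(1 <= d < M.+1) 4 * ((maxn N d)%:R ^+ 2)^-1)).
    apply: ler_sum_nat => d /andP[d1 _].
    have D0 : 0 < d%:R :> R by rewrite ltr0n.
    have M0 : 0 < (maxn N d)%:R :> R by rewrite ltr0n leq_max N0.
    have W0 : 0 <= \sum_(N.+1 <= m < M.+1) w d m.
      by rewrite sumr_ge0// => m _; rewrite divr_ge0// exprn_ge0.
    have W1 : \sum_(N.+1 <= m < M.+1) w d m <= 2 / (d%:R * (maxn N d)%:R).
      exact: sum_dvdn_inv_sqr_le.
    have -> : 4 * ((maxn N d)%:R ^+ 2)^-1 = d%:R ^+ 2 * (2 / (d%:R * (maxn N d)%:R)) ^+ 2 :> R.
      by field; rewrite !gt_eqF.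
    rewrite ler_pM2l ?exprn_gt0//; by apply: lerXn2r; rewrite // nnegrE.
  by rewrite -mulr_sumr ler_pM2l//; exact: sum_inv_max_sqr.
rewrite swap; apply: le_trans (_ : 12^-1 * (4 * (3 / N%:R)) <= _).
  by rewrite ler_pM2l// invr_gt0.
by rewrite le_eqVlt; apply/orP; left; apply/eqP; field; rewrite gt_eqF.
Qed.

End L2Tail.

(** * Almost everywhere convergence and mean convergence on segments *)

Section AlmostEverywhere.
Context {R : realType}.
Notation mu := (@lebesgue_measure R).

Lemma bounded_measurable_phi1_sum (N : nat) : bounded_measurable (fun t : R => phi1_sum t N).
Proof.
rewrite /phi1_sum; apply: bounded_measurable_sum => n _.
under eq_fun do rewrite mulrC.
by apply: bounded_measurableZ; exact: bounded_measurable_B1.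
Qed.

Lemma measurable_phi1_sum (N : nat) : measurable_fun setT (fun t : R => phi1_sum t N).
Proof. by have [] := bounded_measurable_phi1_sum N. Qed.

Lemma phi1_sum_L2_itv (N M : nat) (c : int) (k : nat) : (0 < N <= M)%N ->
  \int[mu]_(t in `[c%:~R, c%:~R + k%:R]) ((phi1_sum t M - phi1_sum t N) ^+ 2) <= k%:R / N%:R :> R.
Proof.
move=> NM; have bS : bounded_measurable (fun t : R => (phi1_sum t M - phi1_sum t N) ^+ 2).
  have b := bounded_measurableB (bounded_measurable_phi1_sum M) (bounded_measurable_phi1_sum N).
  exact: (bounded_measurableM b b).
elim: k => [|k ih]; first by rewrite addr0 set_itv1 Rintegral_set1 mul0r.
rewrite (@Rintegral_chasles _ _ _ (c%:~R + k%:R)); last 2 first.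
- exact: bounded_measurable_integrable.
- by rewrite lerDl ler0n lerD2l ler_nat leqnSn.
rewrite -natr1 mulrDl mul1r lerD//.
have := @phi1_sum_L2 R N M (c + k%:Z) NM; rewrite intrD -pmulrn.
by rewrite -addrA.
Qed.

(** Mean values over arbitrary segments, by [|f| <= s / 2 + f ^ 2 / (2 s)]. *)
Lemma phi1_sum_L1 (a b s : R) (N M : nat) (c : int) (k : nat) : (0 < N <= M)%N ->
  c%:~R <= a -> a <= b -> b <= c%:~R + k%:R -> 0 < s ->
  \int[mu]_(t in `[a, b]) `|phi1_sum t M - phi1_sum t N| <=
    s / 2 * (b - a) + k%:R / (2 * s * N%:R).
Proof.
move=> NM ca ab bk s0; have /andP[N0 _] := NM.
have NR : 0 < N%:R :> R by rewrite ltr0n.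
pose f (t : R) := phi1_sum t M - phi1_sum t N.
have bf : bounded_measurable f.
  exact: bounded_measurableB (bounded_measurable_phi1_sum M) (bounded_measurable_phi1_sum N).
have bff : bounded_measurable (fun t => f t ^+ 2) by exact: (bounded_measurableM bf bf).
have cutl : \int[mu]_(t in `[a, b]) f t ^+ 2 <= k%:R / N%:R.
  apply: le_trans (@phi1_sum_L2_itv N M c k NM).
  rewrite (@Rintegral_chasles _ _ c%:~R a); last 2 first.
  - exact: bounded_measurable_integrable.
  - by rewrite ca (le_trans ab bk).
  rewrite (@Rintegral_chasles _ _ a b (c%:~R + k%:R)); last 2 first.
  - exact: bounded_measurable_integrable.
  - by rewrite ab bk.
  rewrite addrCA lerDl addr_ge0// Rintegral_ge0// => t _; exact: sqr_ge0.
have amgm (t : R) : `|f t| <= s / 2 + (2 * s)^-1 * f t ^+ 2.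
  have h : 0 <= (s - `|f t|) ^+ 2 by exact: sqr_ge0.
  rewrite -(ler_pM2l (_ : 0 < 2 * s)); last by rewrite mulr_gt0.
  rewrite [leRHS](_ : _ = s ^+ 2 + f t ^+ 2); last by field; rewrite gt_eqF.
  by move: h; rewrite sqrrB real_normK ?num_real//; move: (`|f t|) (f t ^+ 2) => u v; lra.
apply: (@le_trans _ _ (\int[mu]_(t in `[a, b]) (s / 2 + (2 * s)^-1 * f t ^+ 2))).
  apply: le_Rintegral => //.
  - exact: bounded_measurable_integrable (bounded_measurable_norm bf).
  - apply: bounded_measurable_integrable; apply: bounded_measurableD.
      exact: bounded_measurable_cst.
    exact: bounded_measurableZ.
  - by move=> t _; exact: amgm.
rewrite RintegralD//; last 2 first.
- exact: bounded_measurable_integrable (bounded_measurable_cst _).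
- exact: bounded_measurable_integrable (bounded_measurableZ _ bff).
rewrite [X in _ + X]RintegralZl//; last exact: bounded_measurable_integrable.
apply: lerD.
  apply: Rintegral_le_bound => //.
  exact: bounded_measurable_integrable (bounded_measurable_cst _).
rewrite [leRHS](_ : _ = (2 * s)^-1 * (k%:R / N%:R)); last by field; rewrite !gt_eqF.
by rewrite ler_wpM2l// invr_ge0 mulr_ge0// ltW.
Qed.

Lemma fourth_power_gap (j : nat) : (j.+2 ^ 4 <= j.+1 ^ 4 + 15 * j.+1 ^ 3)%N.
Proof. by rewrite !expnS !expn0; nia. Qed.

Lemma phi1_sum_block_le (t : R) (N M : nat) : (0 < N <= M)%N ->
  `|phi1_sum t M - phi1_sum t N| <= (M - N)%:R / N%:R.
Proof.
move=> /andP[N0 NM]; have NR : 0 < N%:R :> R by rewrite ltr0n.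
rewrite /phi1_sum (big_cat_nat (n := N.+1))//= addrAC subrr add0r.
apply: le_trans (ler_norm_sum _ _ _) _.
apply: (@le_trans _ _ (\sum_(N.+1 <= n < M.+1) N%:R^-1)).
  apply: ler_sum_nat => n /andP[Nn _].
  have n0 : 0 < n%:R :> R by rewrite ltr0n (leq_ltn_trans _ Nn).
  rewrite normrM normfV (ger0_norm (ltW n0)) -[leRHS]mul1r; apply: ler_pM => //.
  - by apply: le_trans (B1_bound _) _; rewrite invf_le1// ler1n.
  - by rewrite lef_pV2// ler_nat ltnW.
by rewrite sumr_const_nat subSS -[_ *+ (M - N)]mulr_natl.
Qed.

(** The series converges along the fourth powers as soon as the blocks between
    them are summable, and it varies by [O(1 / j)] inside the [j]-th block. *)
Lemma phi1_sum_cvg_of_blocks (t T : R) :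
  (forall n, \sum_(j < n) `|phi1_sum t (j.+2 ^ 4) - phi1_sum t (j.+1 ^ 4)| <= T) ->
  cvgn (phi1_sum t).
Proof.
move=> hT; pose u (j : nat) := phi1_sum t (j.+1 ^ 4).
have cu : cvgn (series (telescope u)).
  apply: normed_cvg.
  have -> : [normed series (telescope u)] = (fun n => \sum_(j < n) `|telescope u j|).
    by apply/funext => n; rewrite /normed_series_of /series /= big_mkord.
  apply: nondecreasing_is_cvgn.
    by apply/nondecreasing_seqP => n; rewrite big_ord_recr/= lerDl normr_ge0.
  by exists T => _ [n _ <-]; exact: hT.
have /cvg_ex[l /cvgrPdist_le hl] := cu.
apply: (cvgP (l + u 0)); apply/cvgrPdist_le => e e0.
have e20 : 0 < e / 2 by rewrite divr_gt0.
have [J _ hJ] := hl _ e20.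
pose K := maxn J (Num.truncn (30 / e)).+1.
exists (K.+1 ^ 4)%N => // N /= KN.
have [j jN jmax] : exists2 j, (j.+1 ^ 4 <= N)%N & (N < j.+2 ^ 4)%N.
  have h : exists j, (j.+1 ^ 4 <= N)%N by exists K.
  have hub j : (j.+1 ^ 4 <= N)%N -> (j <= N)%N.
    apply: leq_trans; rewrite -[leqLHS]expn1.
    by apply: leq_trans (leq_pexp2l _ (isT : (1 <= 4)%N)) => //; rewrite expn1.
  case: (ex_maxnP h hub) => j hj jm; exists j => //.
  by rewrite ltnNge; apply/negP => /jm; rewrite ltnn.
have Kj : (K <= j)%N.
  by rewrite -2!ltnS -(@ltn_exp2r _ _ 4)// (leq_ltn_trans KN).
have h1 : `|l + u 0 - u j| <= e / 2.
  have := hJ j (leq_trans (leq_maxl _ _) Kj); rewrite telescopeK /=.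
  by rewrite opprB addrA.
have h2 : `|phi1_sum t N - u j| <= e / 2.
  have J0 : 0 < j.+1%:R :> R by rewrite ltr0n.
  apply: le_trans (phi1_sum_block_le _ _) _; first by rewrite expn_gt0 jN.
  have gap : (N - j.+1 ^ 4 <= 15 * j.+1 ^ 3)%N.
    by rewrite leq_subLR (leq_trans (ltnW jmax))// fourth_power_gap.
  apply: (@le_trans _ _ ((15 * j.+1 ^ 3)%:R / (j.+1 ^ 4)%:R)).
    by rewrite ler_pM2r ?invr_gt0 ?ltr0n ?expn_gt0// ler_nat.
  rewrite natrM !natrX [leLHS](_ : _ = 15 / j.+1%:R); last by field; rewrite gt_eqF.
  rewrite ler_pdivrMr//.
  have : 30 / e <= j.+1%:R.
    apply: le_trans (ltW (truncnS_gt _)) _; rewrite ler_nat.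
    by apply: leqW; apply: leq_trans Kj; rewrite leq_maxr.
  by rewrite ler_pdivrMr//; move: (j.+1%:R : R); clear => x; lra.
rewrite (_ : l + u 0 - _ = (l + u 0 - u j) - (phi1_sum t N - u j)); last by ring.
apply: le_trans (ler_normB _ _) _; apply: le_trans (lerD h1 h2) _.
by clear; lra.
Qed.

(** The blocks between fourth powers have summable [L1] norms. *)
Lemma phi1_sum_cvg_ae_itv (k : nat) :
  {ae mu, forall t, `[- k%:R, k%:R]%classic t -> cvgn (phi1_sum t)}.
Proof.
pose f (j : nat) (t : R) := `|phi1_sum t (j.+2 ^ 4) - phi1_sum t (j.+1 ^ 4)|.
pose D : set R := `[- k%:R, k%:R]%classic.
have mD : measurable (D : set (measurableTypeR R)) by exact: measurable_itv.
have bf j : bounded_measurable (f j).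
  by apply: bounded_measurable_norm; apply: bounded_measurableB; exact: bounded_measurable_phi1_sum.
pose F (t : R) := (\sum_(j <oo) (f j t)%:E)%E.
have mf j : measurable_fun D (fun t => (f j t)%:E).
  by apply/measurable_EFinP; apply: measurable_funS (bf j).1.
have f0 j t : D t -> (0 <= (f j t)%:E)%E by rewrite lee_fin normr_ge0.
have intf j : (\int[mu]_(t in D) (f j t)%:E <= ((2 * k%:R) / (j.+1%:R ^+ 2))%:E)%E.
  have -> : (\int[mu]_(t in D) (f j t)%:E)%E = (\int[mu]_(t in D) f j t)%:E.
    have fi : mu.-integrable D (EFin \o f j) := bounded_measurable_integrable _ _ (bf j).
    rewrite /Rintegral fineK//. by apply: integrable_fin_num fi.
  rewrite lee_fin.
  have j0 : 0 < j.+1%:R :> R by rewrite ltr0n.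
  (* the integral of the square is at most [2 k / (j + 1) ^ 4]: this [s] balances the
     two terms of [phi1_sum_L1] *)
  have s0 : 0 < (j.+1%:R ^+ 2)^-1 :> R by rewrite invr_gt0 exprn_gt0.
  have jj : (0 < j.+1 ^ 4 <= j.+2 ^ 4)%N by rewrite expn_gt0 leq_exp2r// leqnSn.
  have := @phi1_sum_L1 (- k%:R) k%:R _ _ _ (- k%:Z) (k + k)%N jj _ _ _ s0.
  rewrite mulrNz -pmulrn natrD => /(_ (lexx _)); rewrite addrA addNr add0r => /(_ _ (lexx _)).
  have kk : - k%:R <= k%:R :> R by rewrite ge0_cp.
  move=> /(_ kk) /le_trans; apply; rewrite natrX.
  by rewrite le_eqVlt; apply/orP; left; apply/eqP; field; rewrite gt_eqF.
have intF : (\int[mu]_(t in D) F t < +oo)%E.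
  rewrite integral_nneseries//; apply: (@le_lt_trans _ _ (4 * k%:R)%:E); last by rewrite ltry.
  apply: lime_le.
    by apply: is_cvg_nneseries => j _ _; apply: integral_ge0 => t Dt; exact: f0.
  apply: nearW => n; apply: (@le_trans _ _ (\sum_(0 <= j < n) ((2 * k%:R) / (j.+1%:R ^+ 2))%:E)%E).
    by apply: lee_sum => j _; exact: intf.
  rewrite sumEFin lee_fin -mulr_sumr.
  have -> : \sum_(0 <= j < n) (j.+1%:R ^+ 2)^-1 = \sum_(1 <= j < n.+1) (j%:R ^+ 2)^-1 :> R.
    by rewrite big_add1.
  have := @sum_inv_sqr_le R 0 n; rewrite divr1 => h.
  by apply: le_trans (ler_wpM2l _ h) _ => //; lra.
have F0 t : D t -> (0 <= F t)%E by move=> Dt; apply: nneseries_ge0 => j _ _; exact: f0.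
have intbF : mu.-integrable D F.
  apply/integrableP; split.
    have h := @ge0_emeasurable_sum _ _ _ D (fun j t => (f j t)%:E) xpredT.
    by apply: h => [j t Dt _|j _]; [exact: f0|exact: mf].
  apply: le_lt_trans intF; rewrite le_eqVlt; apply/orP; left; apply/eqP.
  apply: eq_integral => t; rewrite inE => Dt.
  by rewrite gee0_abs// F0.
apply: filterS (integrable_ae mD intbF) => t Ft Dt.
have {}Ft := Ft Dt; apply: (@phi1_sum_cvg_of_blocks _ (fine (F t))) => n.
rewrite -lee_fin fineK//; apply: le_trans (nneseries_lim_ge n _).
  by rewrite sumEFin big_mkord.
by move=> j _ _; exact: f0.
Qed.

Lemma phi1_sum_cvg_ae : {ae mu, forall t : R, cvgn (phi1_sum t)}.
Proof.
have := ae_foralln phi1_sum_cvg_ae_itv; apply: filterS => t h.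
apply: (h (Num.truncn `|t|).+1); rewrite /= in_itv /= -ler_norml.
exact/ltW/truncnS_gt.
Qed.

End AlmostEverywhere.

Section Phi1Integrable.
Context {R : realType}.
Notation mu := (@lebesgue_measure R).

(** The Cauchy criterion writes the set with countable operations. *)
Lemma measurable_cvg_set (h : nat -> R -> R) : (forall n, measurable_fun setT (h n)) ->
  measurable [set t | cvgn (h ^~ t)].
Proof.
move=> mh; rewrite (_ : [set t | _] = \bigcap_(k in setT) \bigcup_(N in setT) \bigcap_(m in setT)
    [set t | `|h (N + m)%N t - h N t| <= k.+1%:R^-1]).
  apply: bigcapT_measurable => k; apply: bigcupT_measurable => N.
  apply: bigcapT_measurable => m.
  have mg : measurable_fun setT (fun t => `|h (N + m)%N t - h N t|).
    by apply: measurableT_comp => //; exact: measurable_funB.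
  have := mg measurableT `]-oo, k.+1%:R^-1]%classic (measurable_itv _).
  rewrite setTI; congr measurable; apply/seteqP; split => t /=; rewrite in_itv //=.
apply/seteqP; split => t /=.
  move=> /cvg_ex[l /cvgrPdist_le hl] k _.
  have k0 : 0 < k.+1%:R^-1 / 2 :> R by rewrite divr_gt0.
  have [N _ hN] := hl _ k0; exists N => // m _ /=.
  rewrite (_ : _ - _ = (l - h N t) - (l - h (N + m)%N t)); last by ring.
  apply: le_trans (ler_normB _ _) _; rewrite [leRHS](splitr k.+1%:R^-1).
  by apply: lerD; apply: hN; rewrite /= ?leq_addr.
move=> ht; apply/cauchy_cvgP/cauchy_exP => e e0.
have [k hk] : exists k : nat, k.+1%:R^-1 < e.
  exists (Num.truncn e^-1); rewrite -[ltRHS]invrK ltf_pV2 ?posrE ?invr_gt0//.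
  exact: truncnS_gt.
have [N _ hN] := ht k I; exists (h N t); exists N => // n /= Nn.
rewrite /ball /= distrC; apply: le_lt_trans hk.
by have := hN (n - N)%N I; rewrite /= subnKC.
Qed.

(** Where the series diverges, [phi1] takes the default value 0, which is also the
    limit of the partial sums cut off outside the set of convergence. *)
Lemma measurable_phi1 : measurable_fun setT (@phi1 R).
Proof.
pose D : set R := [set t | cvgn (phi1_sum t)].
have mD : measurable D by apply: measurable_cvg_set => n; exact: measurable_phi1_sum.
apply: (@measurable_fun_cvg _ _ _ _ (fun n t => phi1_sum t n * \1_D t)) => [n|t _].
  by apply: measurable_funM; [exact: measurable_phi1_sum|exact: measurable_indic].
have [Dt|Dt] := pselect (D t).
  by rewrite indicE mem_set//; under eq_fun do rewrite mulr1; exact: Dt.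
rewrite indicE memNset//; under eq_fun do rewrite mulr0.
by rewrite /phi1 dvgP//; exact: cvg_cst.
Qed.

(** Fatou's lemma applied to the bounds for the partial sums. *)
Lemma phi1_L1 (a b s : R) (N : nat) (c : int) (k : nat) : (0 < N)%N ->
  c%:~R <= a -> a <= b -> b <= c%:~R + k%:R -> 0 < s ->
  (\int[mu]_(t in `[a, b]) `|phi1 t - phi1_sum t N|%:E <=
    (s / 2 * (b - a) + k%:R / (2 * s * N%:R))%:E)%E.
Proof.
move=> N0 ca ab bk s0; set B := _ + _ / _.
pose f (m : nat) (t : R) := `|phi1_sum t (N + m)%N - phi1_sum t N|.
have bf m : bounded_measurable (f m).
  by apply: bounded_measurable_norm; apply: bounded_measurableB; exact: bounded_measurable_phi1_sum.
have mf m : measurable_fun `[a, b] (fun t => (f m t)%:E).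
  by apply/measurable_EFinP; apply: measurable_funS (bf m).1.
have f0 m t : `[a, b]%classic t -> (0 <= (f m t)%:E)%E by rewrite lee_fin normr_ge0.
have intf m : (\int[mu]_(t in `[a, b]) (f m t)%:E <= B%:E)%E.
  have fi : mu.-integrable `[a, b] (EFin \o f m) := bounded_measurable_integrable _ _ (bf m).
  have -> : (\int[mu]_(t in `[a, b]) (f m t)%:E)%E = (\int[mu]_(t in `[a, b]) f m t)%:E.
    by rewrite /Rintegral fineK//; apply: integrable_fin_num fi.
  by rewrite lee_fin; apply: phi1_sum_L1 ca ab bk s0; rewrite N0 leq_addr.
have mphi : measurable_fun `[a, b] (fun t => `|phi1 t - phi1_sum t N|%:E).
  apply/measurable_EFinP; apply: measurableT_comp => //; apply: measurable_funB.
    exact: measurable_funS measurable_phi1.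
  by apply: measurable_funS (measurable_phi1_sum N).
have mlim : measurable_fun `[a, b] (fun t => limn_einf (fun m => (f m t)%:E)).
  apply: measurableT_comp => //; apply: measurable_fun_limn_esup => m.
  exact: measurableT_comp.
have -> : (\int[mu]_(t in `[a, b]) `|phi1 t - phi1_sum t N|%:E =
    \int[mu]_(t in `[a, b]) limn_einf (fun m => (f m t)%:E))%E.
  apply: ae_eq_integral => //.
  have [A [mA A0 hA]] := @phi1_sum_cvg_ae R; exists A; split=> //.
  apply: subset_trans hA => t /=; apply: contra_not => ct _.
  have : (f m t)%:E @[m --> \oo] --> `|phi1 t - phi1_sum t N|%:E.
    apply: cvg_EFin; first by apply: nearW.
    apply: cvg_norm; apply: cvgB; last exact: cvg_cst.
    by have := ct; rewrite -(@cvg_shiftn N); under eq_fun do rewrite addnC.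
  by move=> /cvg_limn_einf_sup[].
have h := @fatou _ _ R mu _ (measurable_itv _) (fun m t => (f m t)%:E) mf f0.
apply: le_trans h _.
rewrite limn_einf_lim; apply: lime_le; first exact: is_cvg_einfs.
apply: nearW => n; apply: le_trans (intf n).
by apply: ereal_inf_lbound; exists n => /=.
Qed.

Lemma phi1_integrable (a b : R) : mu.-integrable `[a, b] (EFin \o phi1).
Proof.
have [ab|ba] := leP a b; last by rewrite set_itv_ge ?bnd_simp -?ltNge//; exact: integrable_set0.
pose c := Num.floor a; pose k := (Num.truncn (b - c%:~R)).+1.
have bk : b <= c%:~R + k%:R.
  by rewrite -lerBlDl; exact/ltW/truncnS_gt.
have bS := bounded_measurable_phi1_sum (R := R) 1.
have i1 : mu.-integrable `[a, b] (EFin \o (fun t => phi1 t - phi1_sum t 1)).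
  apply/integrableP; split.
    apply/measurable_EFinP; apply: measurable_funB.
      exact: measurable_funS measurable_phi1.
    by apply: measurable_funS bS.1.
  by apply: le_lt_trans (phi1_L1 (isT : (0 < 1)%N) (floor_le a) ab bk ltr01) _; exact: ltry.
have i2 : mu.-integrable `[a, b] (EFin \o (fun t => phi1_sum t 1)).
  exact: bounded_measurable_integrable.
rewrite (_ : EFin \o phi1 = (EFin \o (fun t : R => (phi1 t - phi1_sum t 1)%R)) \+ (EFin \o (fun t => phi1_sum t 1%N)))%E.
  exact: integrableD.
by apply/funext => t /=; rewrite -EFinD subrK.
Qed.

Lemma phi1_locally_integrable : locally_integrable setT (@phi1 R).
Proof.
split; [exact: measurable_phi1|exact: openT|move=> K _ cK].
have [M [_ hM]] := compact_bounded cK.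
pose a : R := `|M| + 1.
have Ka : K `<=` `[- a, a].
  move=> t Kt; rewrite /= in_itv /= -ler_norml; apply: (hM a) => //.
  by rewrite /a ltr_pwDr// ler_norm.
have /integrableP[mphi] := phi1_integrable (- a) a; apply: le_lt_trans.
apply: ge0_subset_integral => //; first exact: compact_measurable.
apply/measurable_EFinP; apply: measurableT_comp => //; exact/measurable_EFinP.
Qed.

Lemma phi1_Rintegral_L1 (a b s : R) (N : nat) : (0 < N)%N -> a <= b -> b <= a + 1 -> 0 < s ->
  \int[mu]_(t in `[a, b]) `|phi1 t - phi1_sum t N| <= s / 2 * (b - a) + 1 / (s * N%:R).
Proof.
move=> N0 ab ba s0; have NR : 0 < N%:R :> R by rewrite ltr0n.
have bk : b <= (Num.floor a)%:~R + 2%:R.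
  by have := floorD1_gt a; rewrite intrD; lra.
have h := phi1_L1 N0 (floor_le a) ab bk s0.
rewrite (_ : 1 / (s * N%:R) = 2%:R / (2 * s * N%:R)); last by field; rewrite !gt_eqF.
rewrite -lee_fin; apply: le_trans h; rewrite /Rintegral fineK//.
rewrite ge0_fin_numE; last by apply: integral_ge0 => t _; rewrite lee_fin.
by apply: le_lt_trans (phi1_L1 N0 (floor_le a) ab bk s0) _; exact: ltry.
Qed.

End Phi1Integrable.

(** * Lebesgue points of [phi1] and derivative of [phi2] *)

Section Main.
Context {R : realType}.
Notation mu := (@lebesgue_measure R).

Lemma phi1_dist_integrable (a b c : R) :
  mu.-integrable `[a, b] (EFin \o (fun t => `|phi1 t - c|)).
Proof.
have ic : mu.-integrable `[a, b] (EFin \o (fun=> c)).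
  exact: bounded_measurable_integrable (bounded_measurable_cst c).
exact: segment_integrable_norm (segment_integrableB (phi1_integrable a b) ic).
Qed.

(** The three ranges of the series: the head oscillates little near [x], the
    tail is small in mean, and the head at [x] approximates the value. *)
Lemma phi1_mean_oscillation (x e : R) : unit_irrational (frac_part x) ->
  subexp_irrational (frac_part x) -> cvgn (phi1_sum x) -> 0 < e ->
  exists2 h0 : R, 0 < h0 & forall a b : R, a < b -> b - a < h0 -> a <= x <= b ->
  \int[mu]_(t in `[a, b]) `|phi1 t - phi1 x| <= e * (b - a).
Proof.
(* with about [A / h] terms and [s = e / 4], the tail has mean at most
   [s / 2 + 2 / (s A)], which is less than [e / 2] *)
move=> ux sx cx e0; pose A : R := 32 / e ^+ 2.
have A0 : 0 < A by rewrite divr_gt0// exprn_gt0.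
have e40 : 0 < e / 4 by rewrite divr_gt0.
have [h1 h10 hosc] := phi1_sum_osc ux sx A0 e40.
have /cvgrPdist_le/(_ _ e40)[N1 _ hN1] := cx.
exists (Num.min (Num.min h1 1) (A / (2 * N1.+1%:R))).
  by rewrite !lt_min h10 ltr01 divr_gt0// mulr_gt0.
move=> a b ab; rewrite !lt_min -andbA => /and3P[bah1 ba1 baA] /andP[ax xb].
set h := b - a in bah1 ba1 baA *.
have h0 : 0 < h by rewrite subr_gt0.
pose N := Num.truncn (A / h).
have Ah0 : 0 <= A / h by rewrite divr_ge0 ?ltW.
have /andP[NA AN] := truncn_itv Ah0; rewrite -/N -natr1 in NA AN.
have N1A : N1.+1%:R * 2 <= A / h.
  move: baA; rewrite ltr_pdivlMr ?mulr_gt0// => baA.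
  by rewrite ler_pdivlMr//; move: baA; move: (N1.+1%:R : R); clear => u; lra.
have N12 : 2 <= A / h.
  by apply: le_trans N1A; rewrite ler_peMl// ler1n.
have NN1 : N1.+1%:R <= N%:R :> R.
  by move: N1A AN N12; rewrite -natr1; move: (A / h) (N%:R : R) (N1%:R : R); clear => u v w; lra.
have N0 : (0 < N)%N by move: NN1; rewrite ler_nat; exact: leq_trans.
have NR : 0 < N%:R :> R by rewrite ltr0n.
have tail : \int[mu]_(t in `[a, b]) `|phi1 t - phi1_sum t N| <= e / 2 * h.
  apply: le_trans (phi1_Rintegral_L1 N0 (ltW ab) _ e40) _.
    by move: ba1; rewrite /h; lra.
  have key : 1 / (e / 4 * N%:R) <= e / 4 * h.
    have NAh : A <= 2 * (N%:R * h).
      have : A / h <= 2 * N%:R by move: AN N12; move: (A / h) (N%:R : R); clear => u v; lra.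
      by rewrite ler_pdivrMr// -mulrA.
    rewrite ler_pdivrMr ?mulr_gt0//.
    have -> : e / 4 * h * (e / 4 * N%:R) = e ^+ 2 / 32 * (2 * (N%:R * h)) by field.
    have e1 : e ^+ 2 / 32 * A = 1 by rewrite /A; field; rewrite gt_eqF.
    by rewrite -[leLHS]e1 ler_wpM2l// divr_ge0// sqr_ge0.
  have eh : 0 <= e * h by rewrite mulr_ge0 ?ltW.
  by move: key eh; rewrite -/h; move: (1 / _); clear => u; lra.
have bS := bounded_measurable_phi1_sum (R := R) N.
have i1 : mu.-integrable `[a, b] (EFin \o (fun t => `|phi1 t - phi1_sum t N|)).
  have iS : mu.-integrable `[a, b] (EFin \o (fun t => phi1_sum t N)).
    exact: bounded_measurable_integrable.
  exact: segment_integrable_norm (segment_integrableB (phi1_integrable a b) iS).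
have i2 : mu.-integrable `[a, b] (EFin \o (fun=> e / 2)).
  exact: bounded_measurable_integrable (bounded_measurable_cst _).
have dom t : a <= t <= b -> `|phi1 t - phi1 x| <= `|phi1 t - phi1_sum t N| + e / 2.
  move=> /andP[at_ tb].
  have tx : `|t - x| <= h by rewrite ler_norml /h; move: at_ tb ax xb; lra.
  have o1 := hosc h t (ltac:(by rewrite h0)) tx N NA.
  have o2 : `|phi1 x - phi1_sum x N| <= e / 4.
    by apply: hN1 => /=; move: NN1; rewrite ler_nat; exact: ltnW.
  have -> : phi1 t - phi1 x = (phi1 t - phi1_sum t N) +
     ((phi1_sum t N - phi1_sum x N) - (phi1 x - phi1_sum x N)) by ring.
  apply: le_trans (ler_normD _ _) _; rewrite lerD2l.
  apply: le_trans (ler_normB _ _) _; apply: le_trans (lerD o1 o2) _.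
  by clear; lra.
apply: (@le_trans _ _ (\int[mu]_(t in `[a, b]) (`|phi1 t - phi1_sum t N| + e / 2))).
  apply: le_Rintegral => //; first exact: phi1_dist_integrable.
  exact: segment_integrableD.
rewrite RintegralD//.
have : \int[mu]_(t in `[a, b]) (e / 2) <= e / 2 * h.
  by apply: Rintegral_le_bound => //; exact: ltW.
by move: tail; move: (\int[mu]_(t in _) _) (\int[mu]_(t in _) _); clear => u v; lra.
Qed.

Lemma B2_le1 (t : R) : `|B2 t| <= 1.
Proof.
have := frac_part_itv t; rewrite /B2; move: (frac_part t) => u /andP[u0 u1].
have : 0 <= u * u by rewrite mulr_ge0.
have : u * u <= u by rewrite ler_piMr// ltW.
by rewrite ler_norml expr2; move: (u * u) => v; lra.
Qed.

Lemma phi2_sum_tail (t : R) (M : nat) : (0 < M)%N -> `|phi2_sum t M - phi2 t| <= M%:R^-1.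
Proof.
have [l hl] : exists l, forall M, (0 < M)%N -> `|phi2_sum t M - l| <= M%:R^-1.
  apply: sum_inv_sqr_tail => m m0.
  rewrite normrM normfV (@ger0_norm _ (_ ^+ 2)) ?exprn_ge0//.
  by rewrite ler_piMl ?invr_ge0 ?exprn_ge0// B2_le1.
suff -> : phi2 t = l by exact: hl.
apply/cvg_lim => //; apply/cvgrPdist_le => e e0.
exists (Num.truncn e^-1).+1 => // n /= hn; rewrite distrC.
have n0 : (0 < n)%N by exact: leq_trans hn.
apply: le_trans (hl n n0) _; rewrite -[leRHS]invrK lef_pV2 ?posrE ?invr_gt0 ?ltr0n//.
by apply: le_trans (ltW (truncnS_gt _)) _; rewrite ler_nat.
Qed.

Lemma phi2_sum_diff (a b : R) (N : nat) : a <= b ->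
  phi2_sum b N - phi2_sum a N = 2 * \int[mu]_(t in `[a, b]) phi1_sum t N.
Proof.
move=> ab; rewrite /phi1_sum Rintegral_bounded_sum; last first.
  move=> n _; under eq_fun do rewrite mulrC.
  by apply: bounded_measurableZ; exact: bounded_measurable_B1.
rewrite mulr_sumr /phi2_sum -sumrB; apply: eq_big_nat => n /andP[n0 _].
have nR : 0 < n%:R :> R by rewrite ltr0n.
rewrite RintegralZr//; last exact: bounded_measurable_integrable (bounded_measurable_B1 n).
have -> : \int[mu]_(t in `[a, b]) B1 (n%:R * t) =
    \int[mu]_(t in `[a, b]) ((0 * t + 1) * B1 (n%:R * t)).
  by apply: eq_Rintegral => t _; rewrite mul0r add0r mul1r.
rewrite Rintegral_sawtooth// /sawtooth_primitive; field; rewrite gt_eqF//.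
Qed.

(** Termwise integration, justified by the convergence in mean of the partial sums. *)
Lemma phi2_diff (a b : R) : a <= b -> b <= a + 1 ->
  phi2 b - phi2 a = 2 * \int[mu]_(t in `[a, b]) phi1 t.
Proof.
move=> ab ba; apply/eqP; rewrite -subr_eq0 -normr_le0; apply/ler_addgt0Pl => e e0.
rewrite addr0; pose s := e / 2; have s0 : 0 < s by rewrite divr_gt0.
pose N := (Num.truncn ((2 + 2 / s) / (e / 2))).+1.
have N0 : (0 < N)%N by [].
have NR : 0 < N%:R :> R by rewrite ltr0n.
have NB : (2 + 2 / s) / N%:R <= e / 2.
  have : (2 + 2 / s) / (e / 2) <= N%:R by exact/ltW/truncnS_gt.
  by rewrite !ler_pdivrMr ?divr_gt0// [N%:R * _]mulrC.
have := phi2_sum_tail b N0; have := phi2_sum_tail a N0.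
have bS := bounded_measurable_phi1_sum (R := R) N.
have iS : mu.-integrable `[a, b] (EFin \o (fun t => phi1_sum t N)).
  exact: bounded_measurable_integrable.
have iD : mu.-integrable `[a, b] (EFin \o (fun t => phi1 t - phi1_sum t N)).
  exact: segment_integrableB (phi1_integrable a b) iS.
have d1 : `|\int[mu]_(t in `[a, b]) phi1 t - \int[mu]_(t in `[a, b]) phi1_sum t N| <=
    s / 2 * (b - a) + 1 / (s * N%:R).
  rewrite -RintegralB//; last exact: phi1_integrable.
  apply: le_trans (le_normr_Rintegral _ iD) _ => //.
  exact: phi1_Rintegral_L1.
have e1 : phi2 b - phi2 a - 2 * \int[mu]_(t in `[a, b]) phi1 t =
  (phi2_sum a N - phi2 a) - (phi2_sum b N - phi2 b) -
  2 * (\int[mu]_(t in `[a, b]) phi1 t - \int[mu]_(t in `[a, b]) phi1_sum t N).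
  by rewrite mulrBr -phi2_sum_diff//; ring.
move=> t1 t2; rewrite e1.
apply: le_trans (ler_normB _ _) _; rewrite normrM (ger0_norm (ler0n R 2)).
have t3 := le_trans (ler_normB _ _) (lerD t1 t2).
have d2 := ler_wpM2l (ler0n R 2) d1.
apply: le_trans (lerD t3 d2) _.
have -> : N%:R^-1 + N%:R^-1 + 2 * (s / 2 * (b - a) + 1 / (s * N%:R)) =
  s * (b - a) + (2 + 2 / s) / N%:R by field; rewrite !gt_eqF.
have : s * (b - a) <= s by rewrite ler_piMr ?(ltW s0)//; lra.
by move: NB; rewrite /s; move: ((2 + _) / _); clear => u; lra.
Qed.

End Main.

Theorem proposition26 (R : realType) (lambda : R)
    (hlambda : wilton_number (frac_part lambda)) :
  [/\ cvgn (phi1_sum lambda),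
      lebesgue_point phi1 lambda,
      derivable phi2 lambda 1
    & derive1 phi2 lambda = 2 * phi1 lambda].
Proof.
have [x01 irr cw] := hlambda.
have ux : unit_irrational (frac_part lambda) by split.
have sx := gamma_cvg0_subexp ux (wilton_term_cvg0 cw).
have cl : cvgn (phi1_sum lambda).
  rewrite (_ : phi1_sum lambda = phi1_sum (frac_part lambda)).
    exact: phi1_sum_cvg_wilton.
  by apply/funext => N; rewrite /frac_part -mulrNz phi1_sumDz.
have mean e (e0 : 0 < e) := phi1_mean_oscillation ux sx cl e0.
have lp : lebesgue_point phi1 lambda.
  split; first exact: phi1_locally_integrable.
  apply/cvgrPdist_le => e e0; have [h0 h00 hm] := mean e e0.
  exists h0 => // h /=; rewrite sub0r normrN => hh hn0.
  rewrite sub0r normrN normrM normfV ler_pdivrMl ?normr_gt0// mulrC.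
  have [hp|hm'] := ltP 0 h.
    rewrite /oriented_int lerDl (ltW hp) ger0_norm; last first.
      by apply: Rintegral_ge0 => t _; exact: normr_ge0.
    rewrite (gtr0_norm hp) in hh *.
    by have := hm lambda (lambda + h); rewrite ltrDl addrAC subrr add0r lexx lerDl (ltW hp); apply.
  have hneg : h < 0 by rewrite lt_neqAle hn0.
  rewrite /oriented_int ifF; last by rewrite lerDl leNgt hneg.
  rewrite normrN ger0_norm; last first.
    by apply: Rintegral_ge0 => t _; exact: normr_ge0.
  rewrite (ltr0_norm hneg) in hh *.
  have := hm (lambda + h) lambda.
  by rewrite gtrDl opprD addrA subrr add0r lexx gerDl (ltW hneg); apply.
have dphi2 : h^-1 *: (phi2 (h + lambda) - phi2 lambda) @[h --> 0^'] --> 2 * phi1 lambda.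
  apply/cvgrPdist_le => e e0; have e20 : 0 < e / 2 by rewrite divr_gt0.
  have [h0 h00 hm] := mean _ e20.
  exists (Num.min h0 1); first by rewrite /= lt_min h00 ltr01.
  move=> h /=; rewrite sub0r normrN lt_min => /andP[hh h1] hn0.
  have main (a b : R) : a < b -> b - a < h0 -> b - a < 1 -> a <= lambda <= b ->
      `|2 * phi1 lambda - (b - a)^-1 * (phi2 b - phi2 a)| <= e.
    move=> ab bah ba1 al; have ba0 : 0 < b - a by rewrite subr_gt0.
    rewrite phi2_diff ?(ltW ab)//; last by move: ba1; lra.
    have hI := hm a b ab bah al.
    have -> : 2 * phi1 lambda - (b - a)^-1 * (2 * \int[lebesgue_measure]_(t in `[a, b]) phi1 t) =
      - (2 * (b - a)^-1 * \int[lebesgue_measure]_(t in `[a, b]) (phi1 t - phi1 lambda)).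
      rewrite RintegralB//; last 2 first.
      - exact: phi1_integrable.
      - exact: bounded_measurable_integrable (bounded_measurable_cst _).
      by rewrite Rintegral_segment_cst ?(ltW ab)//; field; rewrite gt_eqF.
    have iD : lebesgue_measure.-integrable `[a, b] (EFin \o (fun t : R => phi1 t - phi1 lambda)).
      have ic : lebesgue_measure.-integrable `[a, b] (EFin \o (fun _ : R => phi1 lambda)).
        exact: bounded_measurable_integrable (bounded_measurable_cst _).
      exact: segment_integrableB (phi1_integrable a b) ic.
    rewrite normrN normrM ger0_norm; last by rewrite mulr_ge0// invr_ge0 ltW.
    have hI2 : `|\int[lebesgue_measure]_(t in `[a, b]) (phi1 t - phi1 lambda)| <= e / 2 * (b - a).
      by apply: le_trans hI; apply: le_normr_Rintegral iD.
    rewrite mulrAC ler_pdivrMr//; move: hI2; move: (`|_|); clear => u; lra.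
  have [hp|hm'] := ltP 0 h.
    have := main lambda (lambda + h); rewrite addrAC subrr add0r (addrC h).
    rewrite (gtr0_norm hp) in hh h1; apply => //; first by rewrite ltrDl.
    by rewrite lexx lerDl ltW.
  have hneg : h < 0 by rewrite lt_neqAle hn0.
  rewrite (ltr0_norm hneg) in hh h1.
  have := main (lambda + h) lambda; rewrite opprD addrA subrr add0r (addrC h).
  rewrite invrN mulNr -mulrN opprB; apply => //; first by rewrite gtrDl.
  by rewrite lexx gerDl ltW.
split; [exact: cl|exact: lp| |].
- apply/cvg_ex; exists (2 * phi1 lambda).
  have -> : (fun h => h^-1 *: ((phi2 \o shift lambda) (h *: 1) - phi2 lambda)) =
    (fun h => h^-1 *: (phi2 (h + lambda) - phi2 lambda)).
    by apply/funext => h /=; rewrite /GRing.scale /= mulr1.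
  exact: dphi2.
- by rewrite /derive1; exact/cvg_lim.
Qed.
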